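(* Let $(M_t)_{t\ge0}$ be a continuous, $L^1$-bounded martingale of the form $M_t=g(t,X_t)$. Then there is a (finite) signed measure $\mu$ on $\mathbb{R}^d$ such that $$M_t=\int_{\mathbb{R}^d}\mathcal{E}(v\cdot X)_t\,\mu(dv)\quad P\text{-a.s. for all }t\ge0.$$ Moreover, $$\sup_{t\ge0}\|M_t\|_1=\|\mu\|.$$
   Context: $X$ is a $d$-dimensional Brownian motion (started at $0$) on a complete probability space $(\Omega,\mathcal{F},P)$ with its Brownian filtration $(\mathcal{F}_t)_{t\ge0}$ (augmented). $L^1$-bounded means $\sup_{t\ge0}\|M_t\|_1<\infty$, where $\|M_t\|_1=E[|M_t|]$. $\mathcal{E}(v\cdot X)_t=\exp\left(v\cdot X_t-\tfrac12|v|^2t\right)$ is the stochastic exponential. $\|\mu\|=|\mu|(\mathbb{R}^d)$ is the total variation norm of $\mu$. *)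

(* Defs.v *)
From HB Require Import structures.
From mathcomp Require Import all_boot all_order all_algebra.
From mathcomp Require Import all_classical all_reals all_analysis.

Set Implicit Arguments.
Unset Strict Implicit.
Unset Printing Implicit Defensive.

Import Order.TTheory GRing.Theory Num.Theory.
Import numFieldNormedType.Exports.

Local Open Scope classical_set_scope.
Local Open Scope ring_scope.

(* R^d is [d.-tuple R]: the library equips it with the product of the Borel
   sigma-algebras of R, i.e. with the Borel sigma-algebra of R^d.
   Processes and filtrations are indexed by all of R, but only the times
   t >= 0 are ever constrained or used. *)

Definition dotp (R : realType) (d : nat) (x y : d.-tuple R) : R :=
  \sum_(i < d) tnth x i * tnth y i.

Definition subtup (R : realType) (d : nat) (x y : d.-tuple R) : d.-tuple R :=
  [tuple tnth x i - tnth y i | i < d].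

Section Stochastic.
Context (disp : measure_display) (Omega : measurableType disp) (R : realType).
Variable P : probability Omega R.

Definition measurable_wrt disp' (E : measurableType disp')
    (G : set (set Omega)) (f : Omega -> E) : Prop :=
  forall B : set E, measurable B -> G (f @^-1` B).

Definition independent (G H : set (set Omega)) : Prop :=
  forall A B, G A -> H B -> P (A `&` B) = (P A * P B)%E.

(* sigma(X_s : 0 <= s <= t) *)
Definition natural_filtration disp' (E : measurableType disp')
    (X : R -> Omega -> E) (t : R) : set (set Omega) :=
  <<s [set A | exists2 s : R, 0 <= s <= t & g_sigma_algebra_preimage (X s) A] >>.

Definition augmented_filtration disp' (E : measurableType disp')
    (X : R -> Omega -> E) (t : R) : set (set Omega) :=
  <<s natural_filtration X t `|` [set A | P.-negligible A] >>.

(* [Y] is a version of E[Z | G] *)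
Definition is_cond_exp (G : set (set Omega)) (Z Y : Omega -> R) : Prop :=
  [/\ measurable_wrt G Y,
      P.-integrable setT (EFin \o Y) &
      forall A, G A ->
        (\int[P]_(w in A) (Y w)%:E = \int[P]_(w in A) (Z w)%:E)%E].

Definition martingale (F : R -> set (set Omega)) (M : R -> Omega -> R) : Prop :=
  [/\ forall t : R, 0 <= t -> measurable_wrt (F t) (M t),
      forall t : R, 0 <= t -> P.-integrable setT (EFin \o M t) &
      forall s t : R, 0 <= s -> s <= t -> is_cond_exp (F s) (M t) (M s)].

Definition continuous_process (M : R -> Omega -> R) : Prop :=
  {ae P, forall w, {within `[0, +oo[, continuous (fun t => M t w)}}.

Definition sup_L1norm (M : R -> Omega -> R) : \bar R :=
  ereal_sup [set 'E_P[(fun w => `|M t w|)%R]%E | t in [set t : R | 0 <= t]].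

(* The increment X_t - X_s has law N(0, (t - s) I_d), i.e. its coordinates are
   independent with law N(0, t - s); this is expressed by the values of the law
   on measurable rectangles. The second parameter of [normal_prob] is the
   standard deviation. *)
Definition brownian_motion (d : nat) (X : R -> Omega -> d.-tuple R) : Prop :=
  [/\ forall t : R, 0 <= t -> measurable_fun setT (X t),
      {ae P, forall w, forall i, tnth (X 0 w) i = 0},
      forall i, continuous_process (fun t w => tnth (X t w) i),
      forall s t : R, 0 <= s -> s < t ->
        independent (natural_filtration X s)
                    (g_sigma_algebra_preimage (fun w => subtup (X t w) (X s w))) &
      forall s t : R, 0 <= s -> s < t ->
        forall B : 'I_d -> set R, (forall i, measurable (B i)) ->
          P [set w | forall i, B i (tnth (subtup (X t w) (X s w)) i)] =
          (\prod_(i < d) normal_prob 0 (Num.sqrt (t - s)) (B i))%E].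

Definition stochastic_exp (d : nat) (v : d.-tuple R)
    (X : R -> Omega -> d.-tuple R) (t : R) (w : Omega) : R :=
  expR (dotp v (X t w) - 2^-1 * dotp v v * t).

End Stochastic.

(* Library charges are real-valued, i.e. finite signed measures. The library's
   Jordan decomposition is relative to a given Hahn decomposition; one is
   chosen here (the resulting measures do not depend on the choice). *)
Section Jordan.
Context (disp : measure_display) (E : measurableType disp) (R : realType).
Variable mu : {charge set E -> \bar R}.

Definition hahn_pos : set E := projT1 (cid (Hahn_decomposition mu)).

Definition hahn_neg : set E :=
  projT1 (cid (projT2 (cid (Hahn_decomposition mu)))).

Lemma hahnP : hahn_decomposition mu hahn_pos hahn_neg.
Proof. exact: (projT2 (cid (projT2 (cid (Hahn_decomposition mu))))). Qed.

Definition tv_measure : set E -> \bar R := charge_variation hahnP.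

(* In the statement f is positive and both integrals are forced to be finite by
   equality with a real number. *)
Definition signed_integral (f : E -> \bar R) : \bar R :=
  (\int[jordan_pos hahnP]_x f x - \int[jordan_neg hahnP]_x f x)%E.

End Jordan.

Arguments signed_integral {disp E R} mu f.
Arguments tv_measure {disp E R} mu _.

(* Main.v *)
Require Import Defs.
From HB Require Import structures.
From mathcomp Require Import all_boot all_order all_algebra.
From mathcomp Require Import ring lra.
From mathcomp Require Import all_classical all_reals all_analysis measurable_realfun.

Set Implicit Arguments.
Unset Strict Implicit.
Unset Printing Implicit Defensive.

Import Order.TTheory GRing.Theory Num.Theory.
Import numFieldNormedType.Exports.

Local Open Scope classical_set_scope.
Local Open Scope ring_scope.

(** If M_t were of the form int E(v.X)_t mu(dv), the law of X_t / t weighted by M_t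
    would be the convolution of mu with N(0, I / t), because under the density
    E(v.X)_t the variable X_t / t has law N(v, I / t).
    So mu has to be the limit of these weighted laws, and the proof shows that the
    limit exists and works.

    Let nu_n and nu'_n be the laws of X_n / n under the measures with densities
    g(n, X_n)^+ and g(n, X_n)^-. Their masses add up to E|M_n|, hence stay
    bounded, and along an ultrafilter on the integers they have vague limits alpha
    and beta ([vague_limit]). This compactness is obtained by encoding a point of
    R^d by the truth values of the inequalities q < x_i, q rational: the limits of
    the masses of the cylinders of the Cantor space form a finitely additive
    function, which extends to a measure by compactness ([cantor_measure]); the
    bit sequences that encode no point of R^d carry the mass lost at infinity.

    For 0 < s < n the Markov property expresses M_s = E[M_n | F_s] as a function
    of X_s: one integrates g(n, X_n) against the ratio of the density of
    N(X_s, (n - s) I) to that of N(0, n I) at X_n ([martingale_kernel]). In terms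
    of u = X_n / n that ratio converges to E(u.X)_s, uniformly in u
    ([gauss_ratio_cvg]), and u |-> E(u.x)_s vanishes at infinity because s > 0
    ([exp_kernel_C0]). Letting n tend to infinity gives
    M_s = int E(v.X)_s (alpha - beta)(dv) almost surely
    ([representation_fixed_time]). Both sides are continuous in s, so the
    exceptional set can be chosen independent of s > 0
    ([representation_positive_times]). At time 0 the kernel is 1 and does not vanish
    at infinity; there M_0 is a constant, which equals E[M_1], and E[E(v.X)_1] = 1
    gives alpha(R^d) - beta(R^d) ([representation_time_zero]).

    With mu = alpha - beta, the total variation is at most alpha(R^d) + beta(R^d),
    which is at most sup E|M_t| since mass can only be lost in the limit.
    Conversely E|M_t| <= |mu|(R^d) for each t, by integrating the representation
    and E[E(v.X)_t] = 1 ([L1norm_le_mass]). *)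

(** * Limits along an ultrafilter *)

(** Limits along an ultrafilter replace the extraction of subsequences: one
    ultrafilter serves for the masses of all the sets at once, and passing to
    the limit is additive. *)
Lemma ultra_bounded_cvg (R : realType) (U : set_system nat) (UU : UltraFilter U)
    (a : nat -> R) (K : R) :
  (forall n, 0 <= a n <= K) -> cvg (a n @[n --> U]).
Proof.
move=> aK.
have aU : UltraFilter (a n @[n --> U]).
  split=> [|G GF aG]; first exact: fmap_proper_filter.
  rewrite predeqE => A; split; last exact: aG.
  move=> GA; have [//|UnA] := in_ultra_setVsetC (a @^-1` A) UU.
  have /aG GnA : (a n @[n --> U]) (~` A) by exact: UnA.
  have : G (A `&` ~` A) by exact: filterI.
  by move=> /filter_ex [? []].
have := @segment_compact R 0 K; rewrite compact_ultra => /(_ _ aU) [].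
  by apply: (@filterE _ U) => n /=; rewrite in_itv/= aK.
by move=> p [_ ap]; apply/cvg_ex; exists p.
Qed.

(** * Finitely additive set functions on the cylinders of the Cantor space *)

Definition agree (n : nat) (c c' : nat -> bool) :=
  forall k, (k < n)%N -> c k = c' k.

Definition cylinder (C : set (nat -> bool)) :=
  exists n, forall c c', agree n c c' -> C c -> C c'.

Lemma agreeS (n m : nat) c c' : (n <= m)%N -> agree m c c' -> agree n c c'.
Proof. by move=> nm cc' k kn; apply: cc'; exact: leq_trans nm. Qed.

Lemma agree_sym n c c' : agree n c c' -> agree n c' c.
Proof. by move=> cc' k kn; rewrite cc'. Qed.

Lemma nbhs_agree (n : nat) (c : cantor_space) :
  \forall c' \near c, agree n c c'.
Proof.
elim: n => [|n IH]; first by apply: filterE => c' k.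
have nn : \forall c' \near c, c n = c' n.
  have := @proj_continuous nat (fun=> bool) n c.
  by move=> /(_ [set b | c n = b]) /=; apply.
apply: filterS2 IH nn => c' cc' ccn k.
by rewrite ltnS leq_eqVlt => /orP[/eqP ->//|]; exact: cc'.
Qed.

Lemma cylinder_near (C : set (nat -> bool)) : cylinder C ->
  forall c : cantor_space, C c -> \forall c' \near c, C c'.
Proof.
by move=> [n Cn] c Cc; apply: filterS (nbhs_agree n c) => c' /Cn; exact.
Qed.

Lemma cylinder0 : cylinder set0.
Proof. by exists 0%N. Qed.

Lemma cylinderU : setU_closed cylinder.
Proof.
move=> A B [n An] [m Bm]; exists (maxn n m) => c c' cc' [Ac|Bc]; [left|right].
  by apply: An Ac; apply: agreeS cc'; exact: leq_maxl.
by apply: Bm Bc; apply: agreeS cc'; exact: leq_maxr.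
Qed.

Lemma cylinderC : setC_closed cylinder.
Proof.
move=> A [n An]; exists n => c c' cc' nAc Ac'.
by apply: nAc; apply: An Ac'; exact: agree_sym.
Qed.

Lemma cylinder_bit (k : nat) (b : bool) : cylinder [set c | c k = b].
Proof. by exists k.+1 => c c' cc' /= <-; rewrite cc'. Qed.

(** The Cantor space, with its cylinders as algebra of sets and without topology;
    the Borel sigma-algebra is generated from that algebra. *)
Definition cyl_space : Type := nat -> bool.
HB.instance Definition _ := Pointed.on cyl_space.

Definition cyl_display : measure_display.
Proof. exact: default_measure_display. Qed.

HB.instance Definition _ := @isAlgebraOfSets.Build cyl_display cyl_space
  cylinder cylinder0 cylinderU cylinderC.

Notation cantor_borel := (g_sigma_algebraType (@measurable _ cyl_space)).

(** Cylinders are open and closed in a compact space. This is why additivity on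
    the cylinders already implies sigma-additivity. *)
Lemma cylinder_cover_finite (A : set cyl_space) (F : (set cyl_space)^nat) :
  cylinder A -> (forall n, cylinder (F n)) -> A `<=` \bigcup_n F n ->
  exists n, A `<=` \big[setU/set0]_(k < n) F k.
Proof.
move=> cA cF AF.
have := cantor_space_compact; rewrite compact_near_coveringP.
move=> /(_ nat \oo (fun n c => A c -> (\big[setU/set0]_(k < n) F k) c)).
case.
  move=> c _; have [Ac|nAc] := pselect (A c); last first.
    exists (~` A, setT) => /=; last by move=> [c' n] /= [].
    by split; [exact: (cylinder_near (cylinderC cA) nAc)|exact: filterT].
  have [k _ Fkc] := AF c Ac.
  exists (F k, [set n | (k < n)%N]) => /=.
    by split; [exact: (cylinder_near (cF k) Fkc)|exact: nbhs_infty_gt].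
  by move=> [c' n] /= [Fkc' kn] _; rewrite -bigcup_mkord; exists k.
by move=> n _ /(_ n) An; exists n => c Ac; apply: An => /=.
Qed.

Section cantor_measure.
Context {R : realType}.
Variable m : set (nat -> bool) -> R.
Hypothesis m_ge0 : forall C, cylinder C -> 0 <= m C.
Hypothesis mU : forall A B, cylinder A -> cylinder B -> A `&` B = set0 ->
  m (A `|` B) = m A + m B.

(** Nothing is assumed about [m] outside the cylinders; [0] is a dummy value there. *)
Definition cyl_content (A : set cyl_space) : \bar R :=
  if `[< cylinder A >] then (m A)%:E else 0%E.

Let cyl_contentE (A : set cyl_space) : cylinder A -> cyl_content A = (m A)%:E.
Proof. by rewrite /cyl_content => cA; rewrite asboolT. Qed.

Let cyl_content0 : cyl_content set0 = 0%E.
Proof.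
rewrite cyl_contentE; last exact: cylinder0.
have := mU cylinder0 cylinder0; rewrite setI0 => /(_ erefl).
by rewrite setU0 => /eqP; rewrite -subr_eq0 opprD addrA subrr sub0r oppr_eq0 => /eqP ->.
Qed.

Let cyl_content_ge0 A : (0 <= cyl_content A)%E.
Proof.
by rewrite /cyl_content; case: asboolP => // cA; rewrite lee_fin m_ge0.
Qed.

Let cyl_content_additive : measure_function.semi_additive cyl_content.
Proof.
apply/(additive2P cyl_content0) => A B cA cB AB0.
by rewrite !cyl_contentE ?mU//; exact: cylinderU.
Qed.

HB.instance Definition _ := @isContent.Build _ cyl_space R cyl_content
  cyl_content_ge0 cyl_content_additive.

Let cyl_content_sigma : measurable_subset_sigma_subadditive cyl_content.
Proof.
move=> A F cF cA AF; have [n An] := cylinder_cover_finite cA cF AF.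
apply: (le_trans (content_subadditive _ _ _ An)) => //.
rewrite -(big_mkord xpredT (fun k => cyl_content (F k))).
exact: nneseries_lim_ge.
Qed.

HB.instance Definition _ := @Content_SigmaSubAdditive_isMeasure.Build _ R
  cyl_space cyl_content cyl_content_sigma.

(** Caratheodory's extension theorem, whose continuity condition comes for free from
    [cylinder_cover_finite]. *)
Lemma cantor_measure : exists mu : {measure set cantor_borel -> \bar R},
  forall C, cylinder C -> mu C = (m C)%:E.
Proof.
exists (measure_extension cyl_content) => C cC.
by rewrite /= /measure_extension measurable_mu_extE//= cyl_contentE.
Qed.

End cantor_measure.

(** * Riemann sums over cells *)

Definition cell (n : nat) (p : n.-tuple bool) : set (nat -> bool) :=
  [set c | forall k : 'I_n, c k = tnth p k].

Definition prefix_of (n : nat) (c : nat -> bool) : n.-tuple bool :=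
  [tuple c k | k < n].

Lemma cell_prefix n (p : n.-tuple bool) c : cell p c <-> prefix_of n c = p.
Proof.
split=> [pc|<- k]; last by rewrite tnth_mktuple.
by apply: eq_from_tnth => k; rewrite tnth_mktuple pc.
Qed.

Lemma cell_agree n (p : n.-tuple bool) c c' : cell p c -> cell p c' ->
  agree n c c'.
Proof. by move=> pc pc' k kn; rewrite (pc (Ordinal kn)) (pc' (Ordinal kn)). Qed.

Lemma cylinder_cell n (p : n.-tuple bool) : cylinder (cell p).
Proof. by exists n => c c' cc' pc k; rewrite -pc cc'. Qed.

Section measurable_bits.
Context d (E : measurableType d) (b : E -> nat -> bool).
Hypothesis mb : forall k, measurable [set x | b x k].

Lemma measurable_bit (k : nat) (v : bool) : measurable [set x | b x k = v].
Proof.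
case: v; first exact: mb.
rewrite (_ : [set x | _] = ~` [set x | b x k]); first exact: measurableC.
by apply/seteqP; split => x /=; [move=> ->|case: (b x k)].
Qed.

Lemma measurable_cell n (p : n.-tuple bool) : measurable (b @^-1` cell p).
Proof.
rewrite (_ : _ @^-1` _ = \bigcap_(k in [set: 'I_n]) [set x | b x k = tnth p k]).
  by apply: fin_bigcap_measurable => // k _; exact: measurable_bit.
by apply/seteqP; split => x /= xp k; [move=> _|]; exact: xp.
Qed.

(** A cylinder set is the finite union of the cells that it meets. *)
Lemma measurable_cylinder C : cylinder C -> measurable (b @^-1` C).
Proof.
move=> [n Cn].
rewrite (_ : _ @^-1` _ =
    \bigcup_(p in [set p : n.-tuple bool | exists2 c, C c & cell p c])
      b @^-1` cell p).
  by apply: fin_bigcup_measurable => // p _; exact: measurable_cell.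
apply/seteqP; split => [x Cx|x [p [c Cc pc] px]] /=.
  exists (prefix_of n (b x)); last exact/cell_prefix.
  by exists (b x) => //; exact/cell_prefix.
by apply: Cn Cc; exact: cell_agree pc px.
Qed.

Variables (R : realType) (nu : {measure set E -> \bar R}) (D : set E).
Hypotheses (mD : measurable D) (nuD : (nu D < +oo)%E).

(** This is the form in which integrals are compared to cylinder masses, both for
    measures on R^d (where [b] is the encoding of points by bits) and for
    measures on the Cantor space (where [b] is the identity and [D] the
    set of sequences on which [h] is uniformly continuous). *)
Lemma cell_sum_approx n (y : n.-tuple bool -> R) (h : E -> R) (e : R) :
  measurable_fun D h -> 0 <= e ->
  (forall x p, D x -> cell p (b x) -> `|h x - y p| <= e) ->
  `| \int[nu]_(x in D) h x -
     \sum_p y p * fine (nu (D `&` b @^-1` cell p)) | <= e * fine (nu D).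
Proof.
move=> mh e0 hy.
pose G x := \sum_p y p * \1_(b @^-1` cell p) x.
have GE x : G x = y (prefix_of n (b x)).
  rewrite /G (bigD1 (prefix_of n (b x)))//= big1 ?addr0.
    by rewrite indicE mem_set ?mulr1//; exact/cell_prefix.
  move=> p pn; rewrite indicE memNset ?mulr0//= => /cell_prefix xp.
  by move: pn; rewrite xp eqxx.
have nuDp p : (nu (D `&` b @^-1` cell p) < +oo)%E.
  by apply: le_lt_trans nuD; apply: measureIl => //; exact: measurable_cell.
have iG p : nu.-integrable D (EFin \o (fun x => y p * \1_(b @^-1` cell p) x)).
  apply: measurable_bounded_integrable => //.
    apply: measurable_funM => //.
    by apply: measurable_indic; exact: measurable_cell.
  exists `|y p|; split=> // M yM x _ /=.
  rewrite (le_trans _ (ltW yM))// normrM indicE ler_piMr//.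
  by case: (_ \in _); rewrite ?normr1 ?normr0.
have iGD : nu.-integrable D (EFin \o G).
  rewrite (_ : _ \o _ =
    (fun x => \sum_p (y p * \1_(b @^-1` cell p) x)%:E)%E); last first.
    by apply/funext => x /=; rewrite /G sumEFin.
  by apply: integrable_sum => // p _; exact: iG.
have iGE : \int[nu]_(x in D) G x =
    \sum_p y p * fine (nu (D `&` b @^-1` cell p)).
  rewrite /Rintegral.
  under eq_integral do rewrite /G -sumEFin.
  rewrite integral_sum// -sum_fine; last first.
    by move=> p _; apply: integrable_fin_num => //; exact: iG.
  apply: eq_bigr => p _.
  rewrite -/(Rintegral _ _ _) RintegralZl//; last first.
    apply: (@le_integrable _ _ _ nu D mD _ (cst 1%E)).
    - by apply/measurable_EFinP/measurable_indic; exact: measurable_cell.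
    - move=> x _ /=; rewrite lee_fin indicE.
      by case: (_ \in _); rewrite ?normr1 ?normr0.
    - apply/integrableP; split=> //.
      by under eq_integral do rewrite /= normr1; rewrite integral_cst ?mul1e.
  rewrite /Rintegral integral_indic//; last exact: measurable_cell.
  by rewrite setIC.
have ih : nu.-integrable D (EFin \o h).
  apply: measurable_bounded_integrable => //.
  exists (e + \sum_p `|y p|); split; first exact: num_real.
  move=> M yM x Dx /=; apply: le_trans (ltW yM).
  have xp : cell (prefix_of n (b x)) (b x) by exact/cell_prefix.
  rewrite -(subrK (y (prefix_of n (b x))) (h x)) (le_trans (ler_normD _ _))//.
  rewrite lerD ?hy//.
  by rewrite (bigD1 (prefix_of n (b x)))//= lerDl sumr_ge0.
rewrite -iGE -RintegralB//.
have ihG : nu.-integrable D (EFin \o (fun x => h x - G x)).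
  rewrite (_ : _ \o _ = (fun x => (h x)%:E - (G x)%:E)%E)//.
  exact: integrableB.
apply: (le_trans (le_normr_Rintegral mD ihG)).
rewrite -Rintegral_cst//; apply: le_Rintegral => //.
- exact: integrable_norm.
- apply: measurable_bounded_integrable => //.
  by exists e; split; [exact: num_real|move=> M eM x _ /=; rewrite ger0_norm// ltW].
- by move=> x Dx; rewrite GE; apply: hy => //; exact/cell_prefix.
Qed.

End measurable_bits.

(** * Vague compactness of bounded families of measures on R^d *)

(** Continuity and vanishing at infinity, spelled out for the supremum norm. *)
Definition C0_fun (R : realType) (d : nat) (f : d.-tuple R -> R) :=
  (forall u e, 0 < e -> exists2 r, 0 < r &
     forall v, (forall i, `|tnth u i - tnth v i| < r) -> `|f u - f v| <= e) /\
  (forall e, 0 < e -> exists N, forall u i, N <= `|tnth u i| -> `|f u| <= e).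

Section decode.
Context {R : realType} {d : nat}.
Implicit Types (x u : d.-tuple R) (c : nat -> bool) (q : rat) (i : 'I_d).

(** The bit of index [bit q i] in the encoding of [x] tells whether [q < x_i]. *)
Definition bit q i : nat := pickle (q, i).

Definition encode x (k : nat) : bool :=
  if (unpickle k : option (rat * 'I_d)) is Some (q, i) then ratr q < tnth x i
  else false.

Lemma encode_bit x q i : encode x (bit q i) = (ratr q < tnth x i).
Proof. by rewrite /encode /bit pickleK. Qed.

(** Monotone bit sequences are families of [d] cuts of the rationals, that is, points
    of the compactification [-oo, +oo]^d; in the proper ones all the
    coordinates are finite. Monotonicity is closed, which properness is not. *)
Definition monotone_bits c := forall q q' i, q <= q' -> c (bit q' i) -> c (bit q i).

Definition proper_bits c := monotone_bits c /\
  forall i, (exists q, c (bit q i)) /\ (exists q, ~~ c (bit q i)).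

Definition decode_coord c i : R := sup [set ratr q | q in [set q | c (bit q i)]].

(** The value on sequences that are not proper is a dummy one. *)
Definition decode c : d.-tuple R :=
  [tuple if `[< proper_bits c >] then decode_coord c i else 0 | i < d].

Lemma tnth_decode c i : proper_bits c -> tnth (decode c) i = decode_coord c i.
Proof. by move=> pc; rewrite tnth_mktuple asboolT. Qed.

Lemma proper_has_sup c i : proper_bits c ->
  has_sup [set (ratr q : R) | q in [set q | c (bit q i)]].
Proof.
move=> [mc /(_ i)[[q cq] [q' cq']]]; split; first by exists (ratr q), q.
exists (ratr q') => _ [p /= cp <-]; rewrite ler_rat leNgt.
by apply/negP => /ltW q'p; move/negP: cq'; apply; exact: mc q'p cp.
Qed.

Lemma decode_ge c q i : proper_bits c -> c (bit q i) -> ratr q <= decode_coord c i.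
Proof.
move=> pc cq; apply: ub_le_sup; last by exists q.
by have [] := proper_has_sup i pc.
Qed.

Lemma decode_le c q i : proper_bits c -> ~~ c (bit q i) ->
  decode_coord c i <= ratr q.
Proof.
move=> pc cq; apply: ge_sup; first by have [] := proper_has_sup i pc.
move=> _ [p /= cp <-]; rewrite ler_rat leNgt.
by apply/negP => /ltW qp; move/negP: cq; apply; exact: pc.1 qp cp.
Qed.

Lemma lt_decode c (a : R) i : proper_bits c -> a < decode_coord c i ->
  exists2 q, a < ratr q & c (bit q i).
Proof.
move=> pc ac; have [_ [q /= cq <-] aq] :=
  sup_gt (proper_has_sup i pc).1 ac.
by exists q.
Qed.

Lemma proper_encode x : proper_bits (encode x).
Proof.
split=> [q q' i qq'|i].
  by rewrite !encode_bit; apply: le_lt_trans; rewrite ler_rat.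
split.
  have /rat_in_itvoo[q] : tnth x i - 1 < tnth x i by rewrite ltrBlDr ltrDl.
  by rewrite in_itv/= => /andP[_ qx]; exists q; rewrite encode_bit.
have /rat_in_itvoo[q] : tnth x i < tnth x i + 1 by rewrite ltrDl.
by move=> /itvP qx; exists q; rewrite encode_bit -leNgt qx.
Qed.

Lemma encodeK x : decode (encode x) = x.
Proof.
apply: eq_from_tnth => i; rewrite tnth_decode; last exact: proper_encode.
apply/eqP; rewrite eq_le; apply/andP; split; rewrite leNgt; apply/negP.
  move=> /(lt_decode (proper_encode x))[q xq].
  by rewrite encode_bit => /lt_trans /(_ xq); rewrite ltxx.
move=> /rat_in_itvoo[q]; rewrite in_itv/= => /andP[qx xq].
have := decode_ge (proper_encode x) (q := q) (i := i).
by rewrite encode_bit => /(_ xq); rewrite leNgt qx.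
Qed.

Lemma measurable_encode k : measurable [set x | encode x k].
Proof.
rewrite /encode; case: (unpickle k) => [[q i]|].
  rewrite (_ : [set x | _] = (fun x => tnth x i) @^-1` `]ratr q, +oo[).
    rewrite -[X in measurable X]setTI.
    by apply: measurable_tnth => //; exact: measurable_itv.
  by apply/seteqP; split => x /=; rewrite in_itv/= andbT.
by rewrite (_ : [set x | _] = set0)//; apply/seteqP; split => x.
Qed.

Definition lift_fun (f : d.-tuple R -> R) c : R :=
  if `[< proper_bits c >] then f (decode c) else 0.

(** [lift_fun f] is continuous on the closed set of monotone sequences. Near a
    sequence that is not monotone, no sequence is; near a proper one, the first bits
    locate the point up to a small distance; near one with an infinite coordinate,
    the first bits force that coordinate to be large, and [f] vanishes at
    infinity. *)
Lemma lift_fun_local (f : d.-tuple R -> R) : C0_fun f ->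
  forall e, 0 < e -> forall c0, exists n y, forall c, monotone_bits c ->
    agree n c0 c -> `|lift_fun f c - y| <= e.
Proof.
move=> [f_cont f0] e e0 c0.
have [mc0|nmc0] := pselect (monotone_bits c0); last first.
  move: nmc0 => /existsNP[q /existsNP[q' /existsNP[i]]].
  move=> /not_implyP[qq' /not_implyP[cq' cq]].
  exists (maxn (bit q i) (bit q' i)).+1, 0 => c mc cc0; exfalso.
  apply: cq; rewrite (cc0 (bit q i)) ?ltnS ?leq_maxl//.
  by apply: mc qq' _; rewrite -(cc0 (bit q' i)) ?ltnS ?leq_maxr.
have [pc0|npc0] := pselect (proper_bits c0).
  pose u := decode c0.
  have [r r0 fr] := f_cont u e e0.
  have uq i : exists qq : rat * rat, [/\ tnth u i - r < ratr qq.1,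
      c0 (bit qq.1 i), ratr qq.2 < tnth u i + r & ~~ c0 (bit qq.2 i)].
    have ui : tnth u i = decode_coord c0 i by rewrite tnth_decode.
    have [|q qr cq] := @lt_decode c0 (tnth u i - r) i pc0.
      by rewrite ui ltrBlDr ltrDl.
    have /rat_in_itvoo[q'] : tnth u i < tnth u i + r by rewrite ltrDl.
    rewrite in_itv/= => /andP[uq' q'r].
    exists (q, q'); split => //=; apply/negP => cq'.
    by have := decode_ge pc0 cq'; rewrite -ui leNgt uq'.
  have [qq qqP] := choice uq.
  exists (\max_(i < d) maxn (bit (qq i).1 i) (bit (qq i).2 i)).+1, (f u).
  move=> c mc cc0.
  have ci1 i : c (bit (qq i).1 i).
    have [_ + _ _] := qqP i; rewrite (cc0 (bit (qq i).1 i))// ltnS.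
    by apply: leq_trans (leq_bigmax i); exact: leq_maxl.
  have ci2 i : ~~ c (bit (qq i).2 i).
    have [_ _ _] := qqP i; rewrite (cc0 (bit (qq i).2 i))// ltnS.
    by apply: leq_trans (leq_bigmax i); exact: leq_maxr.
  have pc : proper_bits c.
    by split=> // i; split; [exists (qq i).1|exists (qq i).2].
  rewrite /lift_fun asboolT// distrC; apply: fr => i.
  have [q1 _ q2 _] := qqP i.
  rewrite [tnth (decode c) i]tnth_decode// ltr_distlC.
  rewrite (lt_le_trans q1) ?decode_ge//=.
  by rewrite (le_lt_trans _ q2)// decode_le.
have [N fN] := f0 e e0.
have : exists i, (forall q, c0 (bit q i)) \/ (forall q, ~~ c0 (bit q i)).
  apply: contrapT => nex; apply: npc0; split=> // i; split.
    apply: contrapT => nq; apply: nex; exists i; right => q.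
    by apply/negP => cq; apply: nq; exists q.
  apply: contrapT => nq; apply: nex; exists i; left => q.
  by apply/negPn/negP => cq; apply: nq; exists q.
move=> [i [allq|noq]].
  have /rat_in_itvoo[q] : N < N + 1 by rewrite ltrDl.
  rewrite in_itv/= => /andP[Nq _].
  exists (bit q i).+1, 0 => c mc cc0; rewrite subr0 /lift_fun.
  case: asboolP => [pc|_]; last by rewrite normr0 ltW.
  apply: (fN _ i); rewrite tnth_decode//.
  apply: le_trans (ler_norm _); apply: (le_trans (ltW Nq)).
  by apply: decode_ge => //; rewrite -(cc0 (bit q i))//; exact: allq.
have /rat_in_itvoo[q] : - N - 1 < - N by rewrite ltrBlDr ltrDl.
rewrite in_itv/= => /andP[_ qN].
exists (bit q i).+1, 0 => c mc cc0; rewrite subr0 /lift_fun.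
case: asboolP => [pc|_]; last by rewrite normr0 ltW.
apply: (fN _ i); rewrite tnth_decode// -normrN.
apply: le_trans (ler_norm _); rewrite lerNr; apply: le_trans (ltW qN).
by apply: decode_le => //; rewrite -(cc0 (bit q i))//; exact: noq.
Qed.

(** Uniform continuity of [lift_fun f], by compactness. *)
Lemma lift_fun_unif (f : d.-tuple R -> R) : C0_fun f ->
  forall e, 0 < e -> exists n, forall c c', monotone_bits c ->
    monotone_bits c' -> agree n c c' -> `|lift_fun f c - lift_fun f c'| <= e.
Proof.
move=> C0f e e0.
have := cantor_space_compact; rewrite compact_near_coveringP.
move=> /(_ nat \oo (fun n c => forall c', monotone_bits c ->
    monotone_bits c' -> agree n c c' -> `|lift_fun f c - lift_fun f c'| <= e)).
case.
  move=> c0 _.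
  have e20 : 0 < e / 2 by rewrite divr_gt0.
  have [n [y ny]] := lift_fun_local C0f e20 c0.
  exists ([set c | agree n c0 c], [set m | (n <= m)%N]) => /=.
    by split; [exact: nbhs_agree|exact: nbhs_infty_ge].
  move=> [c m] /= [cc0 nm] c' mc mc' cc'.
  have c0c' : agree n c0 c'.
    by move=> k kn; rewrite cc0//; apply: cc'; exact: leq_trans nm.
  rewrite -(subrK y (lift_fun f c)) -addrA (le_trans (ler_normD _ _))//.
  by rewrite [leRHS]splitr lerD ?ny// distrC ny.
by move=> n _ /(_ n (leqnn n)) nP; exists n => c c' mc mc' cc'; exact: nP.
Qed.

End decode.

Section decode_measurable.
Context {R : realType} {d : nat}.

Lemma measurable_cyl (C : set cantor_borel) : cylinder C -> measurable C.
Proof. by move=> cC; exact: sub_sigma_algebra. Qed.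

(* [k] enumerates the pairs of rationals and coordinates at which monotonicity may
   fail. *)
Let nonmonotone_at (k : nat) : set cantor_borel :=
  if (unpickle k : option (rat * rat * 'I_d)) is Some (q, q', i) then
    if q <= q' then [set c | c (bit q' i) = true] `&` [set c | c (bit q i) = false]
    else set0
  else set0.

Let cylinder_nonmonotone k : cylinder (nonmonotone_at k).
Proof.
rewrite /nonmonotone_at; case: (unpickle k) => [[[q q'] i]|]; last exact: cylinder0.
case: ifP => _; last exact: cylinder0.
rewrite -[X in cylinder X]setCK setCI.
by apply/cylinderC/cylinderU; apply/cylinderC/cylinder_bit.
Qed.

Let monotone_bitsE :
  ~` (@monotone_bits d : set cantor_borel) = \bigcup_k nonmonotone_at k.
Proof.
apply/seteqP; split => [c|c [k _]].
  move=> /existsNP[q /existsNP[q' /existsNP[i]]].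
  move=> /not_implyP[qq' /not_implyP[cq' /negP cq]].
  exists (pickle (q, q', i)); first exact: Logic.I.
  rewrite /nonmonotone_at pickleK qq'.
  by split => //=; exact/negbTE.
rewrite /nonmonotone_at; case: (unpickle k) => [[[q q'] i]|//].
by case: ifP => //= qq' [cq' cq] /(_ q q' i qq' cq'); rewrite cq.
Qed.

Lemma measurable_monotone_bits :
  measurable (@monotone_bits d : set cantor_borel).
Proof.
rewrite -[X in measurable X]setCK monotone_bitsE.
apply: measurableC; apply: bigcupT_measurable => k.
by apply: measurable_cyl; exact: cylinder_nonmonotone.
Qed.

(** Failure of monotonicity is a countable union of cylinders that contain no encoding
    of a point of R^d. *)
Lemma nonmonotone_bits_null (mu : {measure set cantor_borel -> \bar R}) :
  (forall C : set cantor_borel, cylinder C ->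
     (forall x : d.-tuple R, ~ C (encode x)) -> mu C = 0%E) ->
  mu (~` (@monotone_bits d : set cantor_borel)) = 0%E.
Proof.
move=> mu0.
have N0 k : mu (nonmonotone_at k) = 0%E.
  apply: mu0 => // x; rewrite /nonmonotone_at.
  case: (unpickle k) => [[[q q'] i]|]; last by move=> [].
  have [qq'|_] := boolP (q <= q'); last by move=> [].
  move=> [/= xq' xq].
  by have [/(_ q q' i qq' xq')] := proper_encode x; rewrite xq.
apply/negligibleP; first exact: measurableC measurable_monotone_bits.
rewrite monotone_bitsE; apply: negligible_bigcup => k; apply/negligibleP; last exact: N0.
by apply: measurable_cyl; exact: cylinder_nonmonotone.
Qed.

Lemma measurable_proper_bits : measurable (@proper_bits d : set cantor_borel).
Proof.
rewrite (_ : (@proper_bits d : set _) = (@monotone_bits d : set cantor_borel) `&`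
    \bigcap_(i in [set: 'I_d]) (\bigcup_q [set c | c (bit q i) = true] `&`
                                \bigcup_q [set c | c (bit q i) = false])); last first.
  apply/seteqP; split => c [mc cP]; split => //= i.
    move=> _; have [[q cq] [q' cq']] := cP i.
    by split; [exists q|exists q' => //; exact/negbTE].
  have [[q _ cq] [q' _ cq']] := cP i Logic.I.
  by split; [exists q|exists q'; rewrite cq'].
apply: measurableI; first exact: measurable_monotone_bits.
apply: fin_bigcap_measurable => // i _; apply: measurableI;
  by apply: bigcupT_measurable_rat => q; apply: measurable_cyl; exact: cylinder_bit.
Qed.

Lemma measurable_decode : measurable_fun setT (@decode R d : cantor_borel -> _).
Proof.
apply/measurable_fun_tnthP => i.
apply: (measurability _ (RGenOInfty.measurableE R)) => // _ [_ [a ->] <-].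
pose B : set cantor_borel := @proper_bits d `&`
  \bigcup_q (if a < ratr q then [set c | c (bit q i) = true] else set0).
have mB : measurable B.
  apply: measurableI; first exact: measurable_proper_bits.
  apply: bigcupT_measurable_rat => q; case: ifP => // _.
  by apply: measurable_cyl; exact: cylinder_bit.
pose y (c : cantor_borel) : R := tnth (decode c) i.
have yE c : @proper_bits d c -> y c = decode_coord c i.
  by move=> pc; rewrite /y tnth_mktuple asboolT.
have y0 c : ~ @proper_bits d c -> y c = 0.
  by move=> npc; rewrite /y tnth_mktuple asboolF.
have BE c : B c <-> @proper_bits d c /\ a < y c.
  split=> [[pc [q _]]|[pc]].
    case: ifP => // aq cq; split => //; rewrite yE//.
    by apply: lt_le_trans aq _; exact: decode_ge.
  rewrite yE// => /(lt_decode pc)[q aq cq].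
  by split => //; exists q => //; rewrite aq.
rewrite setTI (_ : _ @^-1` _ = [set c | a < y c]); last first.
  by apply/seteqP; split => c /=; rewrite in_itv/= andbT.
(* Outside [proper_bits] the value is [0], which exceeds [a] only if [a < 0]. *)
have [a0|a0] := ltP a 0.
  rewrite (_ : [set c | _] = B `|` ~` (@proper_bits d : set cantor_borel)).
    by apply: measurableU => //; apply: measurableC; exact: measurable_proper_bits.
  apply/seteqP; split => c /=; last by case=> [/BE[]//|/y0 ->].
  by have [pc ac|] := pselect (@proper_bits d c); [left; apply/BE|right].
rewrite (_ : [set c | _] = B)//.
apply/seteqP; split => c /=; last by move/BE => [].
move=> ac; apply/BE; split=> //; apply: contrapT => /y0 c0.
by move: ac; rewrite c0 ltNge a0.
Qed.

End decode_measurable.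

Lemma cvgr_sum (R : realType) (T I : Type) (F : set_system T) (FF : Filter F)
    (r : seq I) (f : I -> T -> R) (l : I -> R) :
  (forall i, f i x @[x --> F] --> l i) ->
  \sum_(i <- r) f i x @[x --> F] --> \sum_(i <- r) l i.
Proof.
move=> fl; elim: r => [|i r IH].
  by rewrite big_nil; under eq_fun do rewrite big_nil; exact: cvg_cst.
by rewrite big_cons; under eq_fun do rewrite big_cons; exact: cvgD.
Qed.

(** The restriction is what discards the mass that has gone to infinity. *)
Lemma restricted_image_measure d1 d2 (T1 : measurableType d1)
    (T2 : measurableType d2) (R : realType) (mu : {measure set T1 -> \bar R})
    (D : set T1) (f : T1 -> T2) :
  (mu setT < +oo)%E -> measurable D -> measurable_fun setT f ->
  exists nu : {measure set T2 -> \bar R},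
    (forall A, measurable A -> nu A = mu (D `&` f @^-1` A)) /\
    (forall h : T2 -> R, measurable_fun setT h -> [bounded h x | x in setT] ->
       \int[nu]_x h x = \int[mu]_(x in D) h (f x)).
Proof.
move=> muT mD mf.
pose rho : {measure set T1 -> \bar R} := mrestr mu mD.
pose nu0 : {measure set T2 -> \bar R} := pushforward rho f.
pose nu := nu0 mf.
exists nu; split; first by move=> A mA; rewrite /= /pushforward /mrestr setIC.
move=> h mh bh.
have rhofin (A : set T1) : measurable A -> (rho A < +oo)%E.
  move=> mA; rewrite /rho /= /mrestr; apply: le_lt_trans muT.
  by apply: le_measure; rewrite ?inE//; exact: measurableI.
have mhf : measurable_fun setT (h \o f) by exact: measurableT_comp.
have bhf : [bounded h (f x) | x in [set: T1]].
  have [M [Mr hM]] := bh; exists M; split => // N MN x _.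
  exact: hM MN (f x) Logic.I.
have ihf : rho.-integrable setT (EFin \o (h \o f)).
  by apply: measurable_bounded_integrable => //; exact: rhofin.
congr fine.
rewrite /nu /nu0 /= integral_pushforward//; last exact/measurable_EFinP.
rewrite preimage_setT.
have mDC : measurable (~` D) by exact: measurableC.
rewrite (negligible_integral mDC)//; last first.
  by rewrite /rho/= /mrestr setICl measure0.
rewrite setTD setCK; apply: eq_measure_integral => // A mA AD.
by rewrite /rho /= /mrestr setIidl.
Qed.

(** The masses of cylinders converge along [U] to a finitely additive function, hence
    define a measure [mt] on the Cantor space, which is supported by the
    monotone sequences; [alpha] is what [mt] induces on R^d through the proper
    ones. Since [lift_fun f] is uniformly continuous on the monotone sequences,
    integrals of [f] are uniformly close to finite sums over cells, and the
    sums converge. *)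
Theorem vague_limit (R : realType) (d : nat) (U : set_system nat)
    (UU : UltraFilter U) (K : R) (nu : nat -> {measure set (d.-tuple R) -> \bar R}) :
  (forall n, (nu n setT <= K%:E)%E) ->
  exists alpha : {measure set (d.-tuple R) -> \bar R},
    (alpha setT <= (lim (fine (nu n setT) @[n --> U]))%:E)%E /\
    forall f : d.-tuple R -> R, measurable_fun setT f -> C0_fun f ->
      [bounded f x | x in setT] ->
      \int[nu n]_x f x @[n --> U] --> \int[alpha]_x f x.
Proof.
move=> nuK.
have nu_fin n A : measurable A -> nu n A \is a fin_num.
  move=> mA; rewrite ge0_fin_numE//; apply: le_lt_trans (ltry K).
  by apply: le_trans (nuK n); apply: le_measure; rewrite ?inE.
have mE C : cylinder C -> measurable (@encode R d @^-1` C).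
  by move=> cC; apply: measurable_cylinder => //; exact: measurable_encode.
pose a C n := fine (nu n (@encode R d @^-1` C)).
have a_bnd C : cylinder C -> forall n, 0 <= a C n <= K.
  move=> cC n; rewrite fine_ge0//= -lee_fin fineK; last by apply: nu_fin; exact: mE.
  by apply: le_trans (nuK n); apply: le_measure; rewrite ?inE//; exact: mE.
have K0 : 0 <= K.
  by have /andP[] := a_bnd _ cylinder0 0%N; exact: le_trans.
pose m C := lim (a C n @[n --> U]).
have a_cvg C : cylinder C -> a C n @[n --> U] --> m C.
  by move=> cC; exact: (ultra_bounded_cvg UU (a_bnd C cC)).
have m_ge0 C : cylinder C -> 0 <= m C.
  move=> cC; apply: limr_ge; first exact: a_cvg.
  by apply: filterE => n; have /andP[] := a_bnd C cC n.
have m_leK C : cylinder C -> m C <= K.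
  move=> cC; apply: limr_le; first exact: a_cvg.
  by apply: filterE => n; have /andP[] := a_bnd C cC n.
have mU A B : cylinder A -> cylinder B -> A `&` B = set0 ->
    m (A `|` B) = m A + m B.
  move=> cA cB AB0; apply: cvg_lim => //.
  rewrite (_ : (fun n => _) = (fun n => a A n + a B n)); last first.
    apply/funext => n; rewrite /a preimage_setU measureU ?fineD//.
    - by apply: nu_fin; exact: mE.
    - by apply: nu_fin; exact: mE.
    - exact: mE.
    - exact: mE.
    - by rewrite -preimage_setI AB0 preimage_set0.
  exact: cvgD (a_cvg A cA) (a_cvg B cB).
have [mt mtE] := cantor_measure m_ge0 mU.
have cylT : cylinder setT by rewrite -setC0; exact/cylinderC/cylinder0.
have mtT : (mt setT < +oo)%E by rewrite mtE ?ltry.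
have mtV0 : mt (~` (@monotone_bits d : set cantor_borel)) = 0%E.
  apply: (@nonmonotone_bits_null R) => C cC Cx; rewrite mtE//; congr EFin.
  rewrite /m (_ : a C = cst 0) ?lim_cst//.
  apply/funext => n; rewrite /a (_ : _ @^-1` _ = set0) ?measure0//.
  by apply/seteqP; split => // x /Cx.
have mV := measurable_monotone_bits (d := d).
have mD := measurable_proper_bits (d := d).
have [alpha [alphaE alpha_int]] :=
  restricted_image_measure mtT mD (@measurable_decode R d).
exists alpha; split.
  rewrite alphaE// preimage_setT setIT.
  have -> : (lim (fine (nu n setT) @[n --> U]))%:E = mt setT by rewrite mtE.
  by apply: le_measure; rewrite ?inE.
move=> f mf C0f bf.
have mlift : measurable_fun setT (lift_fun f : cantor_borel -> R).
  rewrite (_ : lift_fun f = (f \o decode) \_ (@proper_bits d)); last first.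
    apply/funext => c; rewrite /lift_fun patchE.
    by case: asboolP => pc; [rewrite mem_set|rewrite memNset].
  apply/(measurable_restrictT _ mD); apply: measurable_funTS.
  exact: measurableT_comp mf (@measurable_decode R d).
have -> : \int[alpha]_x f x =
    \int[mt]_(c in (@monotone_bits d : set cantor_borel)) lift_fun f c.
  rewrite alpha_int//.
  have VD : (@monotone_bits d : set cantor_borel) `&` @proper_bits d = @proper_bits d.
    by rewrite setIidr// => c [].
  rewrite -[in LHS]VD.
  rewrite Rintegral_mkcondr; apply: eq_Rintegral => c _.
  rewrite /lift_fun patchE.
  by case: asboolP => pc; [rewrite mem_set|rewrite memNset].
apply/cvgrPdist_le => e e0.
(* With this bound on the oscillation, a Riemann sum is within [e / 3] of the
   integral for every measure of mass at most [K]. *)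
pose e' := e / (3 * (K + 1)).
have K1 : 0 < K + 1 by rewrite ltr_wpDl.
have e'0 : 0 < e' by rewrite divr_gt0// mulr_gt0.
have e'K x : x <= K -> e' * x <= e / 3.
  move=> xK; rewrite /e' invfM mulrA -mulrA ler_piMr//.
    by rewrite divr_ge0// ltW.
  by rewrite mulrC ler_pdivrMr// mul1r (le_trans xK)// lerDl.
have [n fn] := lift_fun_unif C0f e'0.
(* Cells without monotone sequences are never met, and their value [0] is a dummy. *)
pose y (p : n.-tuple bool) : R :=
  xget 0 [set z | exists c, [/\ @monotone_bits d c, cell p c & z = lift_fun f c]].
have yP c p : @monotone_bits d c -> cell p c -> `|lift_fun f c - y p| <= e'.
  move=> mc pc; rewrite /y; case: xgetP => [z _ [c' [mc' pc' ->]]|].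
    by apply: fn => //; exact: cell_agree pc pc'.
  by move=> /(_ (lift_fun f c)) []; exists c.
have f_lift x : f x = lift_fun f (encode x).
  by rewrite /lift_fun asboolT ?encodeK//; exact: proper_encode.
have cvgS : \sum_p y p * a (cell p) k @[k --> U] --> \sum_p y p * m (cell p).
  apply: cvgr_sum => p; apply: cvgM; first exact: cvg_cst.
  by apply: a_cvg; exact: cylinder_cell.
have e30 : 0 < e / 3 by rewrite divr_gt0.
move/cvgrPdist_le : cvgS => /(_ _ e30); apply: filterS => k Sk.
have approx_k : `| \int[nu k]_x f x - \sum_p y p * a (cell p) k | <= e / 3.
  have nukT : (nu k setT < +oo)%E by rewrite (le_lt_trans (nuK k))// ltry.
  have fy x p : [set: d.-tuple R] x -> cell p (encode x) -> `|f x - y p| <= e'.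
    by move=> _ px; rewrite f_lift; apply: yP => //; have [] := proper_encode x.
  have := @cell_sum_approx _ _ (@encode R d) (@measurable_encode R d) _ (nu k)
    setT measurableT nukT n y f e' mf (ltW e'0) fy.
  under eq_bigr do rewrite setTI.
  move=> /le_trans; apply.
  apply: e'K; rewrite -lee_fin fineK ?nuK//.
  exact: nu_fin.
have mtVE (p : n.-tuple bool) :
    mt ((@monotone_bits d : set cantor_borel) `&` id @^-1` cell p)
    = (m (cell p))%:E.
  have mC : measurable (cell p : set cantor_borel).
    by apply: measurable_cyl; exact: cylinder_cell.
  rewrite -mtE; last exact: cylinder_cell.
  rewrite -[in RHS](setIT (cell p)) -(setUv (@monotone_bits d)) setIUr.
  rewrite [RHS]measureU//.
  - rewrite [X in _ = (_ + X)%E](_ : _ = 0%E) ?adde0 1?setIC//.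
    apply: (subset_measure0 _ _ _ mtV0) => //; last exact: measurableC.
    by apply: measurableI => //; exact: measurableC.
  - exact: measurableI.
  - by apply: measurableI => //; exact: measurableC.
  - by rewrite setIACA setICr setI0.
have approx : `| \int[mt]_(c in (@monotone_bits d : set cantor_borel)) lift_fun f c
    - \sum_p y p * m (cell p) | <= e / 3.
  have mV_lt : (mt (@monotone_bits d) < +oo)%E.
    by apply: le_lt_trans mtT; apply: le_measure; rewrite ?inE.
  have := @cell_sum_approx _ cantor_borel id
    (fun k => measurable_cyl (cylinder_bit k true)) _ mt
    (@monotone_bits d) mV mV_lt n y (lift_fun f) e'
    (measurable_funTS mlift) (ltW e'0) (fun c p mc pc => yP c p mc pc).
  under eq_bigr => p _ do rewrite mtVE.
  move=> /le_trans; apply; apply: e'K.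
  rewrite -lee_fin fineK; last by rewrite ge0_fin_numE.
  rewrite (le_trans _ (_ : mt setT <= _)%E)//.
    by apply: le_measure; rewrite ?inE.
  by rewrite mtE// lee_fin m_leK.
move: approx approx_k Sk.
set I := Rintegral _ _ _; set J := Rintegral _ _ _.
set S := \sum_p _; set Sk := \sum_p _ => IS JS SS.
rewrite (_ : I - J = (I - S) + (S - Sk) - (J - Sk)); last by ring.
rewrite (le_trans (ler_normB _ _))// (le_trans (lerD (ler_normD _ _) (lexx _)))//.
by rewrite (_ : e = e / 3 + e / 3 + e / 3) ?lerD//; field.
Qed.

(** * Weighted images of measures *)

Section weighted_image.
Context d1 d2 (T1 : measurableType d1) (T2 : measurableType d2) (R : realType).
Variables (mu : {measure set T1 -> \bar R}) (w : T1 -> R) (phi : T1 -> T2).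
Hypotheses (mw : measurable_fun setT w) (w0 : forall x, 0 <= w x).
Hypothesis mphi : measurable_fun setT phi.
Local Open Scope ereal_scope.

Definition weighted_image (A : set T2) : \bar R :=
  \int[mu]_(x in phi @^-1` A) (w x)%:E.

Let mpre A : measurable A -> measurable (phi @^-1` A).
Proof. by move=> mA; rewrite -[X in measurable X]setTI; exact: mphi. Qed.

Let weighted_image0 : weighted_image set0 = 0.
Proof. by rewrite /weighted_image preimage_set0 integral_set0. Qed.

Let weighted_image_ge0 A : 0 <= weighted_image A.
Proof. by apply: integral_ge0 => x _; rewrite lee_fin. Qed.

Let mw' : measurable_fun setT (EFin \o w). Proof. exact/measurable_EFinP. Qed.

Let w0' x : 0 <= (w x)%:E. Proof. by rewrite lee_fin. Qed.

Let weighted_image_sigma : semi_sigma_additive weighted_image.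
Proof.
move=> F mF tF mUF; rewrite /weighted_image preimage_bigcup.
apply: (semi_sigma_additive_nng_induced (mu := mu) mw' w0'
  (F := fun n => phi @^-1` F n)).
- by move=> n; exact: mpre.
- apply/trivIsetP => i j _ _ ij; rewrite -preimage_setI.
  by move/trivIsetP : tF => /(_ _ _ _ _ ij) ->//; rewrite preimage_set0.
- by rewrite -preimage_bigcup; exact: mpre.
Qed.

HB.instance Definition _ := isMeasure.Build _ _ _ weighted_image
  weighted_image0 weighted_image_ge0 weighted_image_sigma.

Import HBNNSimple.

Let nnsfun_weighted_image (h : {nnsfun T2 >-> R}) :
  \int[weighted_image]_y (h y)%:E = \int[mu]_x ((w x)%:E * (h (phi x))%:E).
Proof.
under [LHS]eq_integral do rewrite fimfunE -fsumEFin//.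
rewrite ge0_integral_fsum//; last 2 first.
  - by move=> r; exact/measurable_EFinP/measurable_funM.
  - by move=> r y _; rewrite EFinM nnfun_muleindic_ge0.
under [RHS]eq_integral => x _.
  rewrite fimfunE -fsumEFin// ge0_mule_fsumr; last first.
    by move=> r; rewrite EFinM nnfun_muleindic_ge0.
  over.
have mr r : measurable_fun setT (fun x : T1 =>
    (r * \1_(h @^-1` [set r]) (phi x))%:E).
  apply/measurable_EFinP/measurable_funM => //.
  by apply: (measurableT_comp _ mphi); exact: measurable_indic.
rewrite ge0_integral_fsum//; last 2 first.
  - by move=> r; exact: emeasurable_funM.
  - by move=> r x _; rewrite mule_ge0// EFinM nnfun_muleindic_ge0.
apply: eq_fsbigr => r /[!inE] -[y _ hyr].
have r0 : (0 <= r)%R by rewrite -hyr.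
rewrite [LHS]integralZl_indic_nnsfun//.
rewrite (@integral_indic _ _ _ weighted_image _ measurableT)// setIT.
under [RHS]eq_integral do rewrite EFinM muleCA.
rewrite ge0_integralZl//; first last.
- by move=> x _; rewrite mule_ge0// lee_fin.
- apply: emeasurable_funM => //; apply/measurable_EFinP.
  by apply: (measurableT_comp _ mphi); exact: measurable_indic.
congr (_ * _); rewrite /weighted_image [LHS]integral_mkcond.
apply: eq_integral => x _; rewrite patchE indicE.
rewrite (_ : (x \in _) = (phi x \in h @^-1` [set r])).
  by case: (_ \in _); rewrite ?mule1 ?mule0.
by apply/idP/idP; rewrite !inE.
Qed.

Lemma ge0_integral_weighted_image (h : T2 -> \bar R) :
  measurable_fun setT h -> (forall y, 0 <= h y) ->
  \int[weighted_image]_y h y = \int[mu]_x ((w x)%:E * h (phi x)).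
Proof.
move=> mh h0; pose h_ := nnsfun_approx measurableT mh.
have h_cvg y : (h_ n y)%:E @[n --> \oo] --> h y.
  exact: cvg_nnsfun_approx.
have nd_h y : {homo (fun n => (h_ n y)%:E) : a b / (a <= b)%N >-> a <= b}.
  by move=> a b ab; rewrite lee_fin; exact/lefP/nd_nnsfun_approx.
have wh_cvg x : (w x)%:E * (h_ n (phi x))%:E @[n --> \oo] --> (w x)%:E * h (phi x).
  exact: cvgeZl.
transitivity (limn (fun n => \int[weighted_image]_y (h_ n y)%:E)).
  rewrite -monotone_convergence//=.
  - by apply: eq_integral => y _; apply/esym/cvg_lim.
  - by move=> n; exact/measurable_EFinP.
  - by move=> n y _; rewrite lee_fin.
under eq_fun do rewrite nnsfun_weighted_image.
rewrite -monotone_convergence//=.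
- by apply: eq_integral => x _; apply/cvg_lim => //; exact: wh_cvg.
- move=> n; apply: emeasurable_funM => //; apply/measurable_EFinP.
  exact: measurableT_comp.
- by move=> n x _; rewrite mule_ge0// lee_fin.
- by move=> x _ a b ab; rewrite lee_wpmul2l//; exact: nd_h.
Qed.

(** A measure with density [w] with respect to [mu], transported by [phi]; it is
    characterized by its integrals, so that no formula for it is needed later. *)
Lemma weighted_image_measure : exists nu : {measure set T2 -> \bar R},
  forall h : T2 -> \bar R, measurable_fun setT h -> (forall y, 0 <= h y) ->
  \int[nu]_y h y = \int[mu]_x ((w x)%:E * h (phi x)).
Proof. by exists weighted_image; exact: ge0_integral_weighted_image. Qed.

End weighted_image.

Lemma measure_integral_indic d (T : measurableType d) (R : realType)
    (mu : {measure set T -> \bar R}) (A : set T) :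
  measurable A -> mu A = (\int[mu]_x (\1_A x)%:E)%E.
Proof. by move=> mA; rewrite integral_indic// setIT. Qed.

(* Finiteness of a measure is a structure, which Fubini's theorem and charges
   require, whereas the measures constructed here come with a bound on their mass.
   The name [copy], which depends on the bound, carries the structure. *)
Section finite_copy.
Context disp (E : measurableType disp) (R : realType).
Variable nu : {measure set E -> \bar R}.

Let copy (nuT : (nu setT < +oo)%E) (A : set E) : \bar R := nu A.

Section instance.
Variable nuT : (nu setT < +oo)%E.

Let copy0 : copy nuT set0 = 0%E. Proof. exact: measure0. Qed.

Let copy_ge0 A : (0 <= copy nuT A)%E. Proof. exact: measure_ge0. Qed.

Let copy_sigma : semi_sigma_additive (copy nuT).
Proof. exact: (@measure_semi_sigma_additive _ _ _ nu). Qed.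

HB.instance Definition _ := isMeasure.Build _ _ _ (copy nuT) copy0 copy_ge0 copy_sigma.

Let copy_fin : fin_num_fun (copy nuT).
Proof. exact: lty_fin_num_fun. Qed.

HB.instance Definition _ := Measure_isFinite.Build _ _ _ (copy nuT) copy_fin.

End instance.

Lemma finite_measure_copy : (nu setT < +oo)%E ->
  exists nu' : {finite_measure set E -> \bar R}, forall A, nu' A = nu A.
Proof. by move=> nuT; exists (copy nuT). Qed.

End finite_copy.

(** * Independent coordinates *)

Section product_law.
Context disp (Omega : measurableType disp) (R : realType) (d : nat).
Variables (P : probability Omega R) (N : probability R R).
Variable Z : Omega -> d.-tuple R.
Hypothesis mZ : measurable_fun setT Z.
Hypothesis Z_law : forall B : 'I_d -> set R, (forall i, measurable (B i)) ->
  P [set w | forall i, B i (tnth (Z w) i)] = (\prod_(i < d) N (B i))%E.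

Let mZi i : measurable_fun setT (fun w => tnth (Z w) i).
Proof. exact: (measurable_fun_tnthP Z).1. Qed.

(** The formula holds for indicators by hypothesis; the indicators are replaced
    by the functions [f i] one coordinate at a time. *)
Lemma integral_prod_coords (f : 'I_d -> R -> R) :
  (forall i, measurable_fun setT (f i)) -> (forall i x, 0 <= f i x) ->
  (forall i, (\int[N]_x (f i x)%:E < +oo)%E) ->
  (\int[P]_w (\prod_(i < d) f i (tnth (Z w) i))%:E =
   \prod_(i < d) \int[N]_x (f i x)%:E)%E.
Proof.
suff main (k : nat) (f' : 'I_d -> R -> R) :
    (forall i, measurable_fun setT (f' i)) -> (forall i x, 0 <= f' i x) ->
    (forall i, (\int[N]_x (f' i x)%:E < +oo)%E) ->
    (forall i : 'I_d, (k <= i)%N -> exists2 B, measurable B & f' i = \1_B) ->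
    (\int[P]_w (\prod_(i < d) f' i (tnth (Z w) i))%:E =
     \prod_(i < d) \int[N]_x (f' i x)%:E)%E.
  move=> mf f0 fN; apply: (main d) => // i.
  by rewrite leqNgt ltn_ord.
elim: k f' => [|k IH] {}f mf f0 fN fB.
  have fB' i : exists B, measurable B /\ f i = \1_B.
    by have [B mB fE] := fB i (leq0n i); exists B.
  have [B BP] := choice fB'.
  have mB i : measurable (B i) by have [] := BP i.
  have fE i : f i = \1_(B i) by have [] := BP i.
  pose A := [set w | forall i, B i (tnth (Z w) i)].
  have mA : measurable A.
    rewrite (_ : A = \bigcap_(i in [set: 'I_d]) (fun w => tnth (Z w) i) @^-1` B i).
      apply: fin_bigcap_measurable => // i _.
      by rewrite -[X in measurable X]setTI; exact: mZi.
    by apply/seteqP; split => w /= Bw i; [move=> _|]; exact: Bw.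
  under eq_integral => w _.
    rewrite (_ : \prod_i f i _ = \1_A w); last first.
      rewrite indicE; have [Aw|nAw] := pselect (A w).
        by rewrite mem_set// big1// => i _; rewrite fE indicE mem_set.
      rewrite memNset//; move/existsNP : nAw => [i nBi].
      by rewrite (bigD1 i)//= fE indicE memNset// mul0r.
    over.
  rewrite integral_indic// setIT [LHS]Z_law//; apply: eq_bigr => i _.
  by rewrite fE integral_indic// setIT.
have [kd|dk] := ltnP k d; last first.
  by apply: IH => // i ki; have := ltn_ord i; rewrite ltnNge (leq_trans dk).
pose i0 := Ordinal kd.
pose w (x : Omega) := \prod_(i < d | i != i0) f i (tnth (Z x) i).
have w0 x : 0 <= w x by apply: prodr_ge0.
have mw : measurable_fun setT w.
  rewrite /w; under eq_fun do rewrite big_mkcond /=.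
  apply: measurable_prod => i _ /=; case: (i != i0) => //=.
  exact: measurableT_comp (mf i) (mZi i).
pose phi (x : Omega) : R := tnth (Z x) i0.
have mphi : measurable_fun setT phi by exact: mZi.
pose c := (\prod_(i < d | i != i0) \int[N]_x (f i x)%:E)%E.
have c0 : (0 <= c)%E.
  by apply: prode_ge0 => i _; apply: integral_ge0 => x _; rewrite lee_fin.
have cfin : c \is a fin_num.
  apply: prode_fin_num => i _; rewrite ge0_fin_numE//.
  by apply: integral_ge0 => x _; rewrite lee_fin.
(* [W] is the law of the coordinate [i0], weighted by the other factors. On sets the
   induction hypothesis identifies it with [c] times [N]; the integral of
   [f i0] follows. *)
have [W WE] := weighted_image_measure P mw w0 mphi.
have step (h : R -> R) : measurable_fun setT h -> (forall x, 0 <= h x) ->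
    (\int[P]_x (\prod_(i < d) (if i == i0 then h else f i) (tnth (Z x) i))%:E =
     \int[W]_x (h x)%:E)%E.
  move=> mh h0; rewrite WE//; last exact/measurable_EFinP.
  apply: eq_integral => x _; rewrite (bigD1 i0)//= eqxx mulrC EFinM.
  by congr (_%:E * _)%E; apply: eq_bigr => i /negbTE ->.
have fstep : (\int[P]_x (\prod_(i < d) f i (tnth (Z x) i))%:E =
     \int[W]_x (f i0 x)%:E)%E.
  rewrite -step//; apply: eq_integral => x _; congr EFin.
  by apply: eq_bigr => i _; case: eqP => [->|].
have weightedE (A : set R) : measurable A ->
    W A = mscale (NngNum (fine_ge0 c0)) N A.
  move=> mA.
  rewrite measure_integral_indic// -step; last 2 first.
  - exact: measurable_indic.
  - by move=> x; rewrite indicE.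
  rewrite (IH (fun i => if i == i0 then \1_A else f i)).
  - rewrite (bigD1 i0)//= eqxx integral_indic//= setIT /mscale/= muleC fineK//.
    by congr (_ * _)%E; apply: eq_bigr => i /negbTE ->.
  - by move=> i; case: eqP => // _; exact: measurable_indic.
  - by move=> i x; case: eqP => // _; rewrite indicE.
  - move=> i; case: eqP => // _; rewrite integral_indic// setIT.
    by rewrite (le_lt_trans (probability_le1 _ _))// ltry.
  - move=> i ki; case: eqP => [_|/eqP ii0]; first by exists A.
    by apply: fB; rewrite ltn_neqAle ki andbT eq_sym.
rewrite fstep (@eq_measure_integral _ _ _ _ (mscale (NngNum (fine_ge0 c0)) N)).
  have mfE : measurable_fun setT (EFin \o f i0) by exact/measurable_EFinP.
  have fE0 x : [set: R] x -> (0 <= (EFin \o f i0) x)%E by move=> _; rewrite /= lee_fin.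
  by rewrite (ge0_integral_mscale _ measurableT _ mfE fE0)/= fineK// [RHS](bigD1 i0)//= muleC.
by move=> A mA _; exact: weightedE.
Qed.

End product_law.

(** * The one-dimensional normal law *)

Section normal_law.
Context {R : realType}.
Local Notation mu := (@lebesgue_measure R).

Lemma lebesgue_measure_shift (x : R) (A : set R) : measurable A ->
  pushforward mu (fun y : R => x + y) A = mu A.
Proof.
move=> mA.
have mx : measurable_fun setT (fun y : measurableTypeR R => x + y : measurableTypeR R).
  exact: measurable_funD.
pose m0 : {measure set (measurableTypeR R) -> \bar R} :=
  pushforward mu (fun y : measurableTypeR R => x + y : measurableTypeR R).
apply/esym; apply: (@lebesgue_measure_unique R (m0 mx)) => // _ [[a b]] _ <-.
rewrite /m0 /= /pushforward.
rewrite (_ : _ @^-1` _ = `](a - x), (b - x)]%classic).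
  by rewrite !lebesgue_measure_itv/= !lte_fin ltrD2r -!EFinB opprB addrA subrK.
by apply/seteqP; split => y /=; rewrite !in_itv/= ltrBlDl lerBrDl.
Qed.

Lemma ge0_integral_shift (x : R) (h : R -> \bar R) :
  measurable_fun setT h -> (forall y, 0 <= h y)%E ->
  (\int[mu]_y h (x + y)%R = \int[mu]_y h y)%E.
Proof.
move=> mh h0.
have mx : measurable_fun setT (fun y : R => x + y) by exact: measurable_funD.
pose m0 : {measure set (measurableTypeR R) -> \bar R} :=
  pushforward mu (fun y : measurableTypeR R => x + y : measurableTypeR R)%R.
rewrite [RHS](@eq_measure_integral _ _ _ setT (m0 mx) mu).
  by rewrite /m0 /= ge0_integral_pushforward// preimage_setT.
by move=> A mA _; rewrite /m0 /=; exact/esym/lebesgue_measure_shift.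
Qed.

Lemma ge0_integral_normal_prob (m s : R) (h : R -> \bar R) :
  measurable_fun setT h -> (forall y, 0 <= h y)%E ->
  (\int[normal_prob m s]_y h y = \int[mu]_y ((normal_pdf m s y)%:E * h y))%E.
Proof.
move=> mh h0.
have [W WE] := weighted_image_measure mu (measurable_normal_pdf m s)
  (normal_pdf_ge0 m s) (@measurable_id _ _ setT).
rewrite -WE//; apply: eq_measure_integral => A mA _.
rewrite [RHS]measure_integral_indic// WE//; last exact/measurable_EFinP/measurable_indic.
rewrite /= /normal_prob integral_mkcond; apply: eq_integral => y _.
by rewrite patchE indicE; case: (_ \in _); rewrite ?mule1 ?mule0.
Qed.

Lemma normal_pdf_sqrt (m t x : R) : 0 < t ->
  normal_pdf m (Num.sqrt t) x =
  (Num.sqrt (t * pi *+ 2))^-1 * expR (- (x - m) ^+ 2 / (t *+ 2)).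
Proof.
move=> t0; rewrite normal_pdfE ?gt_eqF ?sqrtr_gt0//.
by rewrite /normal_peak /normal_fun sqr_sqrtr// ltW.
Qed.

(** The ratio of the densities of N(x, t - s) and N(0, t). *)
Definition gauss_ratio1 (s t x z : R) : R :=
  Num.sqrt (t / (t - s)) *
  expR (z ^+ 2 / (t *+ 2) - (z - x) ^+ 2 / ((t - s) *+ 2)).

Lemma gauss_ratio1_ge0 s t x z : 0 <= gauss_ratio1 s t x z.
Proof. by rewrite mulr_ge0// expR_ge0. Qed.

Lemma gauss_ratio1E s t x z : 0 < s -> s < t ->
  normal_pdf 0 (Num.sqrt t) z * gauss_ratio1 s t x z =
  normal_pdf x (Num.sqrt (t - s)) z.
Proof.
move=> s0 st.
have t0 : 0 < t by exact: lt_trans st.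
have ts0 : 0 < t - s by rewrite subr_gt0.
rewrite !normal_pdf_sqrt// /gauss_ratio1 mulrACA -expRD subr0; congr (_ * expR _).
  have := pi_gt0 R; move: (pi : R) => p p_gt0.
  have p0 : 0 < t * p *+ 2 by rewrite pmulrn_lgt0// mulr_gt0.
  have p1 : 0 < (t - s) * p *+ 2 by rewrite pmulrn_lgt0// mulr_gt0.
  rewrite -(sqrtrV (ltW p0)) -(sqrtrV (ltW p1)) -sqrtrM ?invr_ge0 ?(ltW p0)//.
  suff -> : (t * p *+ 2)^-1 * (t / (t - s)) = ((t - s) * p *+ 2)^-1 by [].
  by field; rewrite !gt_eqF.
by rewrite mulNr addrA addNr add0r mulNr.
Qed.

Lemma measurable_gauss_ratio1 s t x : measurable_fun setT (gauss_ratio1 s t x).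
Proof.
apply: measurable_funM => //; apply: measurableT_comp => //.
apply: measurable_funB; apply: measurable_funM => //; apply: measurable_funX => //.
exact: measurable_funB.
Qed.

(** The translate by [x] of N(0, t - s) is N(x, t - s), which has density
    [gauss_ratio1 s t x] with respect to N(0, t). *)
Lemma gauss_ratio1_integral s t x (B : set R) : 0 < s -> s < t -> measurable B ->
  (\int[normal_prob 0 (Num.sqrt t)]_z (\1_B z * gauss_ratio1 s t x z)%:E =
   normal_prob 0 (Num.sqrt (t - s)) [set y | B (x + y)%R])%E.
Proof.
move=> s0 st mB.
have mBx : measurable [set y | B (x + y)].
  rewrite -[X in measurable X]setTI.
  by apply: (_ : measurable_fun setT (fun y : R => x + y)) => //; exact: measurable_funD.
rewrite ge0_integral_normal_prob; last 2 first.
- apply/measurable_EFinP/measurable_funM; first exact: measurable_indic.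
  exact: measurable_gauss_ratio1.
- by move=> z; rewrite lee_fin mulr_ge0 ?gauss_ratio1_ge0// indicE.
rewrite [RHS]measure_integral_indic// ge0_integral_normal_prob; last 2 first.
- exact/measurable_EFinP/measurable_indic.
- by move=> z; rewrite lee_fin indicE.
rewrite -[LHS](ge0_integral_shift x); last 2 first.
- apply/measurable_EFinP/measurable_funM; first exact: measurable_normal_pdf.
  apply: measurable_funM; first exact: measurable_indic.
  exact: measurable_gauss_ratio1.
- by move=> z; rewrite lee_fin !mulr_ge0 ?gauss_ratio1_ge0 ?normal_pdf_ge0// indicE.
apply: eq_integral => y _; rewrite -!EFinM; congr EFin.
rewrite mulrCA gauss_ratio1E// mulrC; congr (_ * _).
  by rewrite !normal_pdf_sqrt ?subr_gt0// addrAC subrr add0r subr0.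
Qed.

(** The integrand times the density of N(0, t) is the density of N(vt, t). *)
Lemma normal_exp_moment (v t : R) : 0 < t ->
  (\int[normal_prob 0 (Num.sqrt t)]_z (expR (v * z - 2^-1 * (v * v) * t))%:E = 1)%E.
Proof.
move=> t0; rewrite ge0_integral_normal_prob; last 2 first.
- apply/measurable_EFinP; apply: measurableT_comp => //.
  by apply: measurable_funB => //; exact: measurable_funM.
- by move=> z; rewrite lee_fin expR_ge0.
rewrite -(integral_normal_pdf (v * t) (Num.sqrt t)); apply: eq_integral => z _.
rewrite -EFinM; congr EFin; rewrite !normal_pdf_sqrt// -[LHS]mulrA -expRD; congr (_ * expR _).
by field; rewrite gt_eqF.
Qed.

(** [normal_prob] lives on [measurableTypeR R]; this is the same law on the default
    measurable structure of [R], the one of the coordinates of a tuple. *)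
Lemma normal_prob_default (m s : R) : exists N : probability R R,
  (forall A, N A = normal_prob m s A) /\
  forall h : R -> \bar R, measurable_fun setT h -> (forall y, 0 <= h y)%E ->
    (\int[N]_y h y = \int[normal_prob m s]_y h y)%E.
Proof.
have mid : @measurable_fun _ _ (measurableTypeR R) R setT (fun x => x).
  by move=> _ A mA; rewrite setTI.
pose idM : {mfun measurableTypeR R >-> R} :=
  HB.pack (fun x : R => x) (isMeasurableFun.Build _ _ _ _ _ mid).
exists (distribution (normal_prob m s) idM); split=> // h mh h0.
by rewrite ge0_integral_distribution.
Qed.

End normal_law.

(** * Gaussian vectors *)

Lemma measurable_EFin_indic d (T : measurableType d) (R : realType) (A : set T) :
  measurable A -> measurable_fun setT (fun x : T => (\1_A x)%:E : \bar R).
Proof. by move=> mA; apply/measurable_EFinP; exact: measurable_indic. Qed.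

Lemma EFin_indic_ge0 (T : Type) (R : realType) (A : set T) (x : T) :
  (0 <= (\1_A x)%:E :> \bar R)%E.
Proof. by rewrite lee_fin indicE. Qed.

Section tuple_laws.
Context {R : realType} {d : nat}.
Implicit Types x y z : d.-tuple R.

Definition addtup x y : d.-tuple R := [tuple tnth x i + tnth y i | i < d].

Lemma measurable_addtup :
  measurable_fun setT (fun xy : d.-tuple R * d.-tuple R => addtup xy.1 xy.2).
Proof.
apply/measurable_fun_tnthP => i.
rewrite (_ : _ \o _ = fun xy : d.-tuple R * d.-tuple R =>
    tnth xy.1 i + tnth xy.2 i); last first.
  by apply/funext => xy /=; rewrite tnth_mktuple.
by apply: measurable_funD; apply: (measurableT_comp (measurable_tnth i)).
Qed.

Definition rectangle (B : 'I_d -> set R) : set (d.-tuple R) :=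
  [set x | forall i, B i (tnth x i)].

Lemma measurable_rectangle B : (forall i, measurable (B i)) ->
  measurable (rectangle B).
Proof.
move=> mB.
rewrite (_ : rectangle B = \bigcap_(i in [set: 'I_d]) (fun x => tnth x i) @^-1` B i).
  apply: fin_bigcap_measurable => // i _.
  by rewrite -[X in measurable X]setTI; exact: measurable_tnth.
by apply/seteqP; split => x /= Bx i; [move=> _|]; exact: Bx.
Qed.

Lemma tuple_measure_unique (m1 m2 : {measure set (d.-tuple R) -> \bar R}) :
  (m1 setT < +oo)%E ->
  (forall B, (forall i, measurable (B i)) -> m1 (rectangle B) = m2 (rectangle B)) ->
  forall A, measurable A -> m1 A = m2 A.
Proof.
move=> m1T m12.
pose G : set (set (d.-tuple R)) :=
  [set A | exists B, (forall i, measurable (B i)) /\ A = rectangle B].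
have GT : G setT by exists (fun=> setT); split=> //; apply/seteqP; split.
apply: (measure_unique G (fun=> setT)) => //.
- apply/seteqP; split; last first.
    apply: smallest_sub; first exact: sigma_algebra_measurable.
    by move=> _ [B [mB ->]]; exact: measurable_rectangle.
  apply: smallest_sub; first exact: smallest_sigma_algebra.
  move=> A; rewrite -bigcup_seq => -[i _ [B mB <-]].
  apply: sub_sigma_algebra; rewrite setTI.
  exists (fun j => if j == i then B else setT); split.
    by move=> j; case: eqP.
  apply/seteqP; split => x /=; last by move=> /(_ i); rewrite eqxx.
  by move=> Bx j; case: eqP => // ->.
- move=> _ _ [B [mB ->]] [C [mC ->]]; exists (fun i => B i `&` C i); split.
    by move=> i; exact: measurableI.
  apply/seteqP; split => x /=; first by move=> [Bx Cx] i; split.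
  by move=> BC; split => i; have [] := BC i.
- by rewrite bigcup_const.
- by move=> _ [B [mB ->]]; exact: m12.
Qed.

Definition gauss_ratio (s t : R) x z : R :=
  \prod_(i < d) gauss_ratio1 s t (tnth x i) (tnth z i).

Lemma gauss_ratio_ge0 s t x z : 0 <= gauss_ratio s t x z.
Proof. by apply: prodr_ge0 => i _; exact: gauss_ratio1_ge0. Qed.

Lemma measurable_gauss_ratio s t x : measurable_fun setT (gauss_ratio s t x).
Proof.
apply: measurable_prod => i _.
exact: measurableT_comp (measurable_gauss_ratio1 s t _) (measurable_tnth i).
Qed.

Context disp (Omega : measurableType disp) (P : probability Omega R).

Definition gaussian_vector (t : R) (Z : Omega -> d.-tuple R) :=
  measurable_fun setT Z /\
  forall B : 'I_d -> set R, (forall i, measurable (B i)) ->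
    P [set w | forall i, B i (tnth (Z w) i)] =
    (\prod_(i < d) normal_prob 0 (Num.sqrt t) (B i))%E.

(** Both sides are integrals of [f] against measures on R^d. These agree on rectangles,
    where independence of the coordinates reduces the claim to
    [gauss_ratio1_integral]. *)
Lemma gauss_translate (s t : R) (W Z : Omega -> d.-tuple R) x :
  0 < s -> s < t -> gaussian_vector (t - s) W -> gaussian_vector t Z ->
  forall f : d.-tuple R -> \bar R, measurable_fun setT f -> (forall z, 0 <= f z)%E ->
  (\int[P]_w f (addtup x (W w)) =
   \int[P]_w ((gauss_ratio s t x (Z w))%:E * f (Z w)))%E.
Proof.
move=> s0 st [mW Wlaw] [mZ Zlaw] f mf f0.
have mxW : measurable_fun setT (fun w => addtup x (W w)).
  apply: (measurableT_comp measurable_addtup (g := fun w => (x, W w))).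
  exact: measurable_fun_pair.
have mq : measurable_fun setT (fun w => gauss_ratio s t x (Z w)).
  exact: measurableT_comp (measurable_gauss_ratio s t x) mZ.
have m_one : measurable_fun setT (fun _ : Omega => 1 : R) by exact: measurable_cst.
have [m1 m1E] := weighted_image_measure P m_one (fun=> ler01) mxW.
have [m2 m2E] := weighted_image_measure P mq
  (fun w => gauss_ratio_ge0 s t x (Z w)) mZ.
transitivity (\int[m1]_z f z)%E.
  by rewrite m1E//; apply: eq_integral => w _; rewrite mul1e.
rewrite -m2E//; apply: eq_measure_integral => A mA _.
have m1B (B : set (d.-tuple R)) : measurable B ->
    m1 B = P [set w | B (addtup x (W w))].
  move=> mB; rewrite measure_integral_indic// m1E//; last exact: measurable_EFin_indic.
  under eq_integral do rewrite mul1e.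
  rewrite [RHS]measure_integral_indic//.
  by rewrite -[X in measurable X]setTI; exact: mxW.
apply: tuple_measure_unique => //.
  rewrite m1B// (_ : [set _ | _] = setT) ?probability_setT ?ltry//.
move=> B mB; rewrite m1B; last exact: measurable_rectangle.
rewrite (_ : [set w | _] =
    [set w | forall i, [set y | B i (tnth x i + y)] (tnth (W w) i)]); last first.
  by apply/seteqP; split => w /= Bw i; move: (Bw i); rewrite tnth_mktuple.
have mBx i : measurable [set y | B i (tnth x i + y)].
  rewrite -[X in measurable X]setTI.
  have : measurable_fun setT (fun y : R => tnth x i + y) by exact: measurable_funD.
  by apply.
etransitivity; first exact: (Wlaw (fun i => [set y | B i (tnth x i + y)]) mBx).
rewrite measure_integral_indic; last exact: measurable_rectangle.
rewrite m2E; last 2 first.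
- by apply: measurable_EFin_indic; exact: measurable_rectangle.
- by move=> y; exact: EFin_indic_ge0.
transitivity (\int[P]_w (\prod_(i < d)
    (\1_(B i) (tnth (Z w) i) * gauss_ratio1 s t (tnth x i) (tnth (Z w) i)))%:E)%E.
  have [N [NE N_int]] := normal_prob_default 0 (Num.sqrt t).
  have ZlawN (C : 'I_d -> set R) : (forall i, measurable (C i)) ->
      P [set w | forall i, C i (tnth (Z w) i)] = (\prod_(i < d) N (C i))%E.
    by move=> mC; rewrite Zlaw//; apply: eq_bigr => i _; rewrite NE.
  have mBq i : measurable_fun setT
      (fun z : R => \1_(B i) z * gauss_ratio1 s t (tnth x i) z).
    apply: measurable_funM; first exact: measurable_indic.
    exact: measurable_gauss_ratio1.
  have Bq0 i (z : R) : 0 <= \1_(B i) z * gauss_ratio1 s t (tnth x i) z.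
    by rewrite mulr_ge0 ?gauss_ratio1_ge0// indicE.
  have Nq i : (\int[N]_z (\1_(B i) z * gauss_ratio1 s t (tnth x i) z)%:E =
      normal_prob 0 (Num.sqrt (t - s)) [set y | B i (tnth x i + y)%R])%E.
    rewrite N_int ?gauss_ratio1_integral//; first exact/measurable_EFinP.
    by move=> z; rewrite lee_fin.
  rewrite (integral_prod_coords mZ ZlawN
    (f := fun (i : 'I_d) (z : R) => \1_(B i) z * gauss_ratio1 s t (tnth x i) z)).
  - by apply: eq_bigr => i _; rewrite Nq.
  - exact: mBq.
  - exact: Bq0.
  - move=> i; rewrite Nq; apply: le_lt_trans (ltry 1).
    by apply: probability_le1; exact: mBx.
apply: eq_integral => w _; rewrite big_split/= mulrC EFinM; congr (_ * _%:E)%E.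
rewrite indicE; have [Bw|nBw] := pselect (rectangle B (Z w)).
  by rewrite mem_set// big1// => i _; rewrite indicE mem_set//; exact: Bw.
rewrite memNset//; move/existsNP : nBw => [i nBi].
by rewrite (bigD1 i)//= indicE memNset// mul0r.
Qed.

(** Conditioning on [Xs]: the increment [W] is independent of [Xs], so that it can
    be integrated separately, and [gauss_translate] turns the integral over the
    increment into one over [Xt]. *)
Lemma markov_kernel (s t : R) (Xs Xt W : Omega -> d.-tuple R) :
  0 < s -> s < t -> measurable_fun setT Xs ->
  gaussian_vector (t - s) W -> gaussian_vector t Xt ->
  (forall w, Xt w = addtup (Xs w) (W w)) ->
  (forall A B, measurable A -> measurable B ->
     P (Xs @^-1` A `&` W @^-1` B) = P (Xs @^-1` A) * P (W @^-1` B))%E ->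
  forall f : d.-tuple R -> \bar R, measurable_fun setT f -> (forall z, 0 <= f z)%E ->
  let F x := (\int[P]_w' ((gauss_ratio s t x (Xt w'))%:E * f (Xt w')))%E in
  measurable_fun setT F /\
  forall B, measurable B ->
    (\int[P]_(w in Xs @^-1` B) f (Xt w) = \int[P]_(w in Xs @^-1` B) F (Xs w))%E.
Proof.
move=> s0 st mXs gW gXt XtE indep f mf f0 F.
have mW : measurable_fun setT W by have [] := gW.
pose XsM : {mfun Omega >-> d.-tuple R} := HB.pack Xs (isMeasurableFun.Build _ _ _ _ Xs mXs).
pose WM : {mfun Omega >-> d.-tuple R} := HB.pack W (isMeasurableFun.Build _ _ _ _ W mW).
have mXW : measurable_fun setT (fun w => (Xs w, W w)) by exact: measurable_fun_pair.
pose XWM : {mfun Omega >-> (d.-tuple R * d.-tuple R)%type} :=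
  HB.pack (fun w => (Xs w, W w)) (isMeasurableFun.Build _ _ _ _ _ mXW).
pose gam : probability _ R := distribution P XsM.
pose eta : probability _ R := distribution P WM.
have joint C : measurable C -> (gam \x eta)%E C = distribution P XWM C.
  move=> mC; apply: product_measure_unique => [A B mA mB|]; last exact: mC.
  exact: indep mA mB.
have mfadd : measurable_fun setT (fun xy : d.-tuple R * d.-tuple R =>
    f (addtup xy.1 xy.2)).
  exact: measurableT_comp mf measurable_addtup.
have FE x : F x = fubini_F eta (fun xy => f (addtup xy.1 xy.2)) x.
  rewrite /F /fubini_F -(gauss_translate x s0 st gW gXt mf f0).
  rewrite ge0_integral_distribution//=.
  exact: measurableT_comp mfadd (pair1_measurable x).
have mF : measurable_fun setT F.
  rewrite (_ : F = fubini_F eta (fun xy => f (addtup xy.1 xy.2))).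
    exact: measurable_fun_fubini_tonelli_F.
  by apply/funext.
split=> // B mB.
have mXsB : measurable (Xs @^-1` B).
  by rewrite -[X in measurable X]setTI; exact: (mXs measurableT B mB).
have restrE (g : Omega -> \bar R) : (\int[P]_(w in Xs @^-1` B) g w =
    \int[P]_w ((\1_B (Xs w))%:E * g w))%E.
  rewrite integral_mkcond; apply: eq_integral => w _; rewrite patchE indicE.
  rewrite (_ : (w \in _) = (Xs w \in B)); last by apply/idP/idP; rewrite !inE.
  by case: (_ \in B); rewrite ?mul1e ?mul0e.
pose h (xy : d.-tuple R * d.-tuple R) := ((\1_B xy.1)%:E * f (addtup xy.1 xy.2))%E.
have h0 xy : (0 <= h xy)%E by rewrite mule_ge0// lee_fin indicE.
have m1B : measurable_fun setT (fun x : d.-tuple R => (\1_B x)%:E : \bar R).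
  exact: measurable_EFin_indic.
have mh : measurable_fun setT h.
  by apply: emeasurable_funM => //; exact: (measurableT_comp m1B).
rewrite !restrE.
transitivity (\int[distribution P XWM]_xy h xy)%E.
  rewrite ge0_integral_distribution//; apply: eq_integral => w _.
  by rewrite /h /= XtE.
transitivity (\int[gam \x eta]_xy h xy)%E.
  by apply: eq_measure_integral => C mC _; exact: esym (joint C mC).
rewrite fubini_tonelli1//.
have F0 x : (0 <= F x)%E.
  by apply: integral_ge0 => w _; rewrite mule_ge0// lee_fin gauss_ratio_ge0.
transitivity (\int[gam]_x ((\1_B x)%:E * F x))%E.
  apply: eq_integral => x _; rewrite FE /fubini_F /= -ge0_integralZl//.
  exact: measurableT_comp mfadd (pair1_measurable x).
rewrite ge0_integral_distribution//.
- exact: emeasurable_funM.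
- by move=> x; rewrite mule_ge0// lee_fin indicE.
Qed.
End tuple_laws.

(** * The exponential kernel *)

Section exp_kernel.
Context {R : realType} {d : nat}.
Implicit Types x u v : d.-tuple R.

(** The stochastic exponential E(v.X)_t as a function of the position [x] of X_t
    and of [v]. *)
Definition exp_kernel (t : R) x v : R :=
  expR (dotp v x - 2^-1 * dotp v v * t).

Lemma exp_kernel_ge0 t x v : 0 <= exp_kernel t x v.
Proof. exact: expR_ge0. Qed.

Lemma dotp_ge0 x : 0 <= dotp x x.
Proof. by apply: sumr_ge0 => i _; rewrite -expr2 sqr_ge0. Qed.

Lemma measurable_dotp d1 (T : measurableType d1) (f g : T -> d.-tuple R) :
  measurable_fun setT f -> measurable_fun setT g ->
  measurable_fun setT (fun z => dotp (f z) (g z)).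
Proof.
move=> mf mg; apply: measurable_sum => i.
by apply: measurable_funM; exact: measurableT_comp (measurable_tnth i) _.
Qed.

Lemma measurable_exp_kernel d1 (T : measurableType d1) t (f g : T -> d.-tuple R) :
  measurable_fun setT f -> measurable_fun setT g ->
  measurable_fun setT (fun z => exp_kernel t (f z) (g z)).
Proof.
move=> mf mg; apply: measurableT_comp => //.
apply: measurable_funB; first exact: measurable_dotp.
by apply: measurable_funM => //; apply: measurable_funM => //; exact: measurable_dotp.
Qed.

Lemma exponentE (t : R) x v : dotp v x - 2^-1 * dotp v v * t =
  \sum_(i < d) (tnth v i * tnth x i - 2^-1 * t * tnth v i ^+ 2).
Proof.
rewrite mulrAC /dotp [2^-1 * t * _]big_distrr/= -sumrB.
by apply: eq_bigr => i _; rewrite expr2.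
Qed.

(** Completing the square. *)
Lemma exponent_le (t : R) x v : 0 < t ->
  dotp v x - 2^-1 * dotp v v * t <= dotp x x / (2 * t).
Proof.
move=> t0; rewrite exponentE /dotp big_distrl/=.
apply: ler_sum => i _; rewrite ler_pdivlMr ?mulr_gt0//.
set a := tnth v i; set b := tnth x i.
rewrite -subr_ge0 (_ : _ - _ = (b - a * t) ^+ 2) ?sqr_ge0//.
by field.
Qed.

Lemma exp_kernel_le (t : R) x v : 0 < t ->
  exp_kernel t x v <= expR (dotp x x / (2 * t)).
Proof. by move=> t0; rewrite ler_expR exponent_le. Qed.

Lemma expR_lip (a b c : R) : a <= c -> b <= c ->
  `|expR a - expR b| <= `|a - b| * expR c.
Proof.
wlog ab : a b / b <= a.
  move=> H ac bc; have [/H ->//|/ltW /H] := leP b a.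
  by rewrite distrC (distrC a); apply.
move=> ac _; rewrite !ger0_norm ?subr_ge0 ?ler_expR//.
have -> : expR a - expR b = expR a * (1 - expR (b - a)).
  by rewrite mulrBr mulr1 -expRD (_ : a + (b - a) = b)//; ring.
rewrite mulrC; apply: ler_pM; rewrite ?expR_ge0 ?ler_expR//.
  by rewrite subr_ge0 -[leRHS]expR0 ler_expR subr_le0.
rewrite lerBlDr -lerBlDl (_ : 1 - (a - b) = 1 + (b - a)); last by ring.
exact: expR_ge1Dx.
Qed.

(** Continuity: the exponents are bounded above by [exponent_le], and the exponential is
    Lipschitz below that bound. Decay: by another completion of the square the
    exponent is at most [2 Y - t |u|^2 / 4]. *)
Lemma exp_kernel_C0 (t : R) x : 0 < t -> C0_fun (exp_kernel t x).
Proof.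
move=> t0; set Y := dotp x x / (2 * t); split=> [u e e0|e e0].
  pose S := \sum_(i < d) (`|tnth x i| + 2^-1 * t * (2 * `|tnth u i| + 1)).
  have S0 : 0 <= S.
    apply: sumr_ge0 => i _; rewrite addr_ge0// mulr_ge0 ?addr_ge0 ?mulr_ge0//.
    exact: ltW.
  pose r := Num.min 1 (e / ((S + 1) * expR Y)).
  have SY : 0 < (S + 1) * expR Y by rewrite mulr_gt0 ?expR_gt0// ltr_wpDl.
  have r0 : 0 < r by rewrite lt_min ltr01 divr_gt0.
  exists r => // v uv.
  rewrite (le_trans (expR_lip (exponent_le x u t0) (exponent_le x v t0)))//.
  rewrite -/Y.
  have uvS : `|dotp u x - 2^-1 * dotp u u * t - (dotp v x - 2^-1 * dotp v v * t)| <= r * S.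
    rewrite !exponentE -sumrB /S big_distrr/=.
    rewrite (le_trans (ler_norm_sum _ _ _))//; apply: ler_sum => i _.
    have := uv i; set a := tnth u i; set b := tnth v i; set c := tnth x i => ab.
    rewrite (_ : _ - _ = (a - b) * (c - 2^-1 * t * (a + b))); last by field.
    rewrite normrM; apply: ler_pM => //; first exact: ltW.
    rewrite (le_trans (ler_normB _ _))// lerD2l normrM ger0_norm ?mulr_ge0 ?(ltW t0)//.
    rewrite ler_wpM2l ?mulr_ge0 ?(ltW t0)//.
    rewrite (_ : a + b = 2 * a - (a - b)); last by ring.
    rewrite (le_trans (ler_normB _ _))// normrM ger0_norm// lerD2l.
    by rewrite (le_trans (ltW ab))// ge_min lexx.
  rewrite (le_trans (ler_wpM2r (expR_ge0 _) uvS))//.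
  rewrite (@le_trans _ _ (r * ((S + 1) * expR Y)))//.
    by rewrite -mulrA ler_pM2l// ler_wpM2r ?expR_ge0// lerDl.
  by rewrite -ler_pdivlMr// ge_min lexx orbT.
pose N := Num.max 1 (4 / t * (expR (2 * Y) / e)).
exists N => u i Nu; rewrite ger0_norm ?exp_kernel_ge0//.
have N1 : 1 <= N by rewrite le_max lexx.
have N0 : 0 < N by exact: lt_le_trans N1.
have uN : N <= tnth u i ^+ 2.
  rewrite -real_normK ?num_real// expr2 (le_trans Nu)//.
  by rewrite ler_peMr// (le_trans N1).
have bnd : dotp u x - 2^-1 * dotp u u * t <= 2 * Y - t / 4 * N.
  rewrite (@le_trans _ _ (2 * Y - t / 4 * tnth u i ^+ 2))//; last first.
    by rewrite lerD2l lerN2 ler_wpM2l// divr_ge0// ltW.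
  rewrite lerBrDr (@le_trans _ _ (dotp u x - 2^-1 * dotp u u * t + t / 4 * dotp u u))//.
    rewrite lerD2l ler_wpM2l ?divr_ge0 ?(ltW t0)//.
    rewrite /dotp (bigD1 i)//= expr2 lerDl.
    by apply: sumr_ge0 => j _; rewrite -expr2 sqr_ge0.
  rewrite exponentE /Y /dotp [t / 4 * _]big_distrr/= [_ / (2 * t)]big_distrl/=.
  rewrite [2 * _]big_distrr/= -big_split/=.
  apply: ler_sum => j _; set a := tnth u j; set c := tnth x j.
  rewrite -subr_ge0 (_ : _ - _ = (2 * c - a * t) ^+ 2 / (4 * t)); last first.
    by field; rewrite gt_eqF.
  by rewrite divr_ge0 ?sqr_ge0// mulr_ge0// ltW.
rewrite (le_trans (_ : _ <= expR (2 * Y - t / 4 * N)))// ?ler_expR//.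
rewrite expRD expRN ler_pdivrMr ?expR_gt0//.
have tN : expR (2 * Y) / e <= t / 4 * N.
  rewrite -ler_pdivrMl ?divr_gt0// invf_div le_max; apply/orP; right.
  exact: lexx.
rewrite (@le_trans _ _ (e * (t / 4 * N)))//.
  by rewrite [leRHS]mulrC -ler_pdivrMr.
rewrite ler_wpM2l ?(ltW e0)// (le_trans _ (expR_ge1Dx _))// lerDr.
exact: ler01.
Qed.

Definition scaletup (a : R) u : d.-tuple R := [tuple a * tnth u i | i < d].

Lemma measurable_scaletup a : measurable_fun setT (scaletup a).
Proof.
apply/measurable_fun_tnthP => i.
rewrite (_ : _ \o _ = fun u : d.-tuple R => a * tnth u i); last first.
  by apply/funext => u /=; rewrite tnth_mktuple.
by apply: measurable_funM => //; exact: measurable_tnth.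
Qed.

(** At [z = t u] the squares combine: up to a factor that tends to [1], the ratio is
    the power [t / (t - s)] of [exp_kernel s x u]. *)
Lemma gauss_ratio_scale (s t : R) x u : s < t -> t != 0 ->
  gauss_ratio s t x (scaletup t u) =
  Num.sqrt (t / (t - s)) ^+ d * expR (- dotp x x / (2 * (t - s))) *
  expR (t / (t - s) * (dotp u x - 2^-1 * dotp u u * s)).
Proof.
move=> st t0; have ts : t - s != 0 by rewrite gt_eqF// subr_gt0.
rewrite /gauss_ratio /gauss_ratio1 big_split/= prodr_const card_ord -mulrA -expRD.
congr (_ * _); rewrite -expR_sum; congr expR.
rewrite exponentE /dotp -sumrN [_ / (2 * (t - s))]big_distrl/=.
rewrite [t / (t - s) * _]big_distrr/= -big_split/=; apply: eq_bigr => i _; rewrite tnth_mktuple.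
by field; rewrite ts t0.
Qed.

(** [theta] is to be thought of as close to [1]; since [y] is bounded above, the
    estimate is uniform although [y] ranges down to minus infinity. *)
Lemma expR_scale_dist (theta Y y : R) : 1 <= theta <= 2 -> 0 <= Y -> y <= Y ->
  `|expR (theta * y) - expR y| <= (theta - 1) * (Y * expR (2 * Y) + 1).
Proof.
move=> /andP[t1 t2] Y0 yY.
have t10 : 0 <= theta - 1 by rewrite subr_ge0.
have tyy : theta * y - y = (theta - 1) * y by ring.
have Ye0 : 0 <= Y * expR (2 * Y) by rewrite mulr_ge0// expR_ge0.
have [y0|y0] := leP 0 y.
  have c1 : theta * y <= 2 * Y by apply: ler_pM => //; exact: le_trans t1.
  have c2 : y <= 2 * Y by rewrite (le_trans yY)// ler_peMl// ler1n.
  rewrite (le_trans (expR_lip c1 c2))// tyy normrM !ger0_norm// -mulrA.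
  by rewrite ler_wpM2l// (le_trans (ler_wpM2r (expR_ge0 _) yY))// lerDl.
have c1 : theta * y <= y by rewrite ler_neMl ?(ltW y0)// .
rewrite (le_trans (expR_lip c1 (lexx y)))// tyy normrM ger0_norm// -mulrA.
rewrite ler_wpM2l// (@le_trans _ _ 1)//; last by rewrite lerDr.
rewrite ltr0_norm// -[y in expR y]opprK expRN ler_pdivrMr ?expR_gt0// mul1r.
by rewrite (le_trans _ (expR_ge1Dx _))// lerDr.
Qed.

Lemma inv_shift_cvg (s : R) : (n%:R - s)^-1 @[n --> \oo] --> (0 : R).
Proof.
apply/cvgrPdist_le => e e0; near=> n.
have ns : s + e^-1 <= n%:R by near: n; exact: nbhs_infty_ger.
have ens : e^-1 <= n%:R - s by rewrite lerBrDl.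
have ns0 : 0 < n%:R - s by rewrite (lt_le_trans _ ens)// invr_gt0.
by rewrite sub0r normrN ger0_norm ?invr_ge0 ?(ltW ns0)// invf_ple ?posrE.
Unshelve. all: by end_near. Qed.

(** The prefactor and the power [1 + s / (n - s)] in [gauss_ratio_scale] tend to [1]; as
    the exponent is bounded above independently of [u], the convergence is uniform. *)
Lemma gauss_ratio_cvg (s : R) x : 0 < s -> forall e, 0 < e ->
  \forall n \near \oo, forall u,
    `|gauss_ratio s n%:R x (scaletup n%:R u) - exp_kernel s x u| <= e.
Proof.
move=> s0 e e0; set Y := dotp x x / (2 * s).
have Y0 : 0 <= Y by rewrite divr_ge0 ?dotp_ge0// mulr_ge0// ltW.
pose del (n : nat) := s * (n%:R - s)^-1.
have del_cvg : del n @[n --> \oo] --> (0 : R).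
  by rewrite -[X in _ --> X](mulr0 s); apply: cvgM; [exact: cvg_cst|exact: inv_shift_cvg].
pose A (n : nat) := Num.sqrt (1 + del n) ^+ d * expR (- dotp x x / 2 * (n%:R - s)^-1).
have sqrt_cvg : Num.sqrt (1 + del n) @[n --> \oo] --> (1 : R).
  have : 1 + del n @[n --> \oo] --> (1 : R).
    by rewrite -[X in _ --> X]addr0; apply: cvgD => //; exact: cvg_cst.
  by move/cvg_comp => /(_ _ _ _ (@sqrt_continuous R 1)); rewrite sqrtr1.
have exp_cvg : expR (- dotp x x / 2 * (n%:R - s)^-1) @[n --> \oo] --> (1 : R).
  have : - dotp x x / 2 * (n%:R - s)^-1 @[n --> \oo] --> (0 : R).
    rewrite -[X in _ --> X](mulr0 (- dotp x x / 2)).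
    by apply: cvgM; [exact: cvg_cst|exact: inv_shift_cvg].
  by move/cvg_comp => /(_ _ _ _ (@continuous_expR R 0)); rewrite expR0.
have A_cvg : A n @[n --> \oo] --> (1 : R).
  rewrite -[X in _ --> X](mulr1 1); apply: cvgM => //.
  by move/cvg_comp : sqrt_cvg => /(_ _ _ _ (@exprn_continuous R d 1)); rewrite expr1n.
pose D n := `|A n - 1| * expR (2 * Y) + del n * (Y * expR (2 * Y) + 1).
have D_cvg : D n @[n --> \oo] --> (0 : R).
  rewrite (_ : 0 = `|1 - 1| * expR (2 * Y) + 0 * (Y * expR (2 * Y) + 1)); last first.
    by rewrite subrr normr0 !mul0r addr0.
  apply: cvgD; apply: cvgM => //; try exact: cvg_cst.
  by apply: cvg_norm; apply: cvgB => //; exact: cvg_cst.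
have del_near : \forall n \near \oo, `|0 - del n| <= 1.
  by move/cvgrPdist_le : del_cvg; apply.
have D_near : \forall n \near \oo, `|0 - D n| <= e.
  by move/cvgrPdist_le : D_cvg; apply.
near=> n => u.
have ns : s < n%:R by near: n; exact: nbhs_infty_gtr.
have ns0 : 0 < n%:R - s by rewrite subr_gt0.
have n0 : n%:R != 0 :> R by rewrite gt_eqF// (lt_trans s0).
have thE : n%:R / (n%:R - s) = 1 + del n.
  by rewrite /del; field; rewrite gt_eqF.
have del0 : 0 <= del n by rewrite mulr_ge0 ?invr_ge0// ltW.
have del1 : del n <= 1.
  have : `|0 - del n| <= 1 by near: n; exact: del_near.
  by rewrite sub0r normrN ger0_norm.
have th0 : 0 <= 1 + del n by rewrite addr_ge0.
have th2 : 1 + del n <= 2 by rewrite (_ : 2 = 1 + 1 :> R) ?lerD2l.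
have Dn : D n <= e.
  have : `|0 - D n| <= e by near: n; exact: D_near.
  by rewrite sub0r normrN; apply: le_trans; exact: ler_norm.
rewrite gauss_ratio_scale// thE.
have -> : - dotp x x / (2 * (n%:R - s)) = - dotp x x / 2 * (n%:R - s)^-1.
  by rewrite invfM mulrA.
rewrite -/(A n) /exp_kernel; set y := dotp u x - _.
have yY : y <= Y by exact: exponent_le.
apply: le_trans Dn; rewrite /D.
have -> : A n * expR ((1 + del n) * y) - expR y =
    (A n - 1) * expR ((1 + del n) * y) + (expR ((1 + del n) * y) - expR y) by ring.
rewrite (le_trans (ler_normD _ _))// lerD//.
  rewrite normrM ler_wpM2l// ger0_norm ?expR_ge0// ler_expR.
  have [y0|y0] := leP 0 y.
    by apply: ler_pM.
  rewrite (@le_trans _ _ 0)//; last by rewrite mulr_ge0.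
  by rewrite pmulr_rle0 ?ltW// ltr_pwDl.
have := @expR_scale_dist (1 + del n) Y y.
rewrite (_ : 1 + del n - 1 = del n); last by ring.
by apply => //; rewrite lerDl del0 th2.
Unshelve. all: by end_near. Qed.

End exp_kernel.

(** * Martingales that are functions of Brownian motion *)

Section brownian_martingale.
Context {R : realType} {disp : measure_display} {Omega : measurableType disp}.
Context (P : probability Omega R) {d : nat}.
Variable X : R -> Omega -> d.-tuple R.
Hypothesis X_BM : brownian_motion P X.

Lemma ae_eq_measure (A B : set Omega) : measurable A -> measurable B ->
  {ae P, forall w, A w <-> B w} -> P A = P B.
Proof.
move=> mA mB AB; rewrite !measure_integral_indic//.
apply: ge0_ae_eq_integral => //; try exact: measurable_EFin_indic.
apply: filterS AB => w AB _; rewrite /= !indicE.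
by have -> : (w \in A) = (w \in B) by apply/idP/idP; rewrite !inE => /AB.
Qed.

Lemma measurable_BM t : 0 <= t -> measurable_fun setT (X t).
Proof. by have [mX _ _ _ _] := X_BM; exact: mX. Qed.

Lemma BM0_ae : {ae P, forall w, X 0 w = [tuple 0 | i < d]}.
Proof.
have [_ X0 _ _ _] := X_BM; apply: filterS X0 => w X0w.
by apply: eq_from_tnth => i; rewrite X0w tnth_mktuple.
Qed.

Lemma gaussian_increment s t : 0 <= s -> s < t ->
  gaussian_vector P (t - s) (fun w => subtup (X t w) (X s w)).
Proof.
move=> s0 st; have [mX _ _ _ incr] := X_BM; split; last exact: incr.
apply/measurable_fun_tnthP => i.
rewrite (_ : _ \o _ = fun w => tnth (X t w) i - tnth (X s w) i); last first.
  by apply/funext => w /=; rewrite tnth_mktuple.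
have t0 : 0 <= t by rewrite (le_trans s0)// ltW.
by apply: measurable_funB; apply: (measurableT_comp (measurable_tnth i)); exact: mX.
Qed.

Lemma gaussian_BM t : 0 < t -> gaussian_vector P t (X t).
Proof.
move=> t0; have mX := measurable_BM (ltW t0); split=> // B mB.
have [mW Wlaw] := gaussian_increment (lexx 0) t0.
move: Wlaw => /(_ B mB); rewrite subr0 => <-.
apply: ae_eq_measure.
- by rewrite -[X in measurable X]setTI; exact: (mX measurableT _ (measurable_rectangle mB)).
- by rewrite -[X in measurable X]setTI; exact: (mW measurableT _ (measurable_rectangle mB)).
apply: filterS BM0_ae => w Xw; rewrite /= Xw.
by split => Bw i; move: (Bw i); rewrite !tnth_mktuple subr0.
Qed.

Lemma BM_filtration s (B : set (d.-tuple R)) : 0 <= s -> measurable B ->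
  natural_filtration X s (X s @^-1` B).
Proof.
move=> s0 mB; apply: sub_sigma_algebra; exists s; first by rewrite s0 lexx.
by exists B => //; rewrite setTI.
Qed.

Lemma BM_independent s t (A B : set (d.-tuple R)) : 0 <= s -> s < t ->
  measurable A -> measurable B ->
  P (X s @^-1` A `&` (fun w => subtup (X t w) (X s w)) @^-1` B) =
  (P (X s @^-1` A) * P ((fun w => subtup (X t w) (X s w)) @^-1` B))%E.
Proof.
move=> s0 st mA mB; have [_ _ _ indep _] := X_BM.
apply: (indep s t s0 st); first exact: BM_filtration.
by exists B => //; rewrite setTI.
Qed.

Variables (M : R -> Omega -> R) (g : R -> d.-tuple R -> R).
Hypothesis M_mart : martingale P (augmented_filtration P X) M.
Hypothesis g_meas : forall t, 0 <= t -> measurable_fun setT (g t).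
Hypothesis M_g : forall t, 0 <= t -> {ae P, forall w, M t w = g t (X t w)}.

Lemma martingale_integrable t : 0 <= t -> P.-integrable setT (EFin \o M t).
Proof. by move=> t0; have [_ iM _] := M_mart; exact: iM. Qed.

Lemma martingale_event s t (B : set (d.-tuple R)) : 0 <= s -> s <= t ->
  measurable B ->
  (\int[P]_(w in X s @^-1` B) (M s w)%:E = \int[P]_(w in X s @^-1` B) (M t w)%:E)%E.
Proof.
move=> s0 st mB; have [_ _ cond] := M_mart; have [_ _] := cond s t s0 st.
apply; apply: sub_sigma_algebra; left; exact: BM_filtration.
Qed.

Let mgX t : 0 <= t -> measurable_fun setT (fun w => g t (X t w)).
Proof. by move=> t0; exact: measurableT_comp (g_meas t0) (measurable_BM t0). Qed.

Lemma integral_martingale t (A : set Omega) : 0 <= t -> measurable A ->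
  (\int[P]_(w in A) (M t w)%:E = \int[P]_(w in A) (g t (X t w))%:E)%E.
Proof.
move=> t0 mA; apply: ae_eq_integral => //.
- apply: measurable_funTS; exact: measurable_int (martingale_integrable t0).
- by apply: measurable_funTS; apply/measurable_EFinP; exact: mgX.
- by apply: filterS (M_g t0) => w -> _.
Qed.

Lemma integrable_gX t : 0 <= t -> P.-integrable setT (fun w => (g t (X t w))%:E).
Proof.
move=> t0; have /integrableP[mM iM] := martingale_integrable t0.
apply/integrableP; split; first by apply/measurable_EFinP; exact: mgX.
rewrite (_ : (\int[P]_w _ = \int[P]_w `|(EFin \o M t) w|)%E)//.
apply: ae_eq_integral => //.
- by apply: measurableT_comp => //; apply/measurable_EFinP; exact: mgX.
- exact: measurableT_comp.
- by apply: filterS (M_g t0) => w /= ->.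
Qed.

(** The mean of [f] under N(x, (t - s) I), the transition law of Brownian motion from
    time [s] to time [t], written as an integral over the law of X_t. *)
Definition kernel_mean (f : d.-tuple R -> R) (s t : R) (x : d.-tuple R) : \bar R :=
  (\int[P]_w ((gauss_ratio s t x (X t w))%:E * (f (X t w))%:E))%E.

(** Both sides are functions of X_s, since [M s] is almost surely [g s (X s)].
    Hence it suffices that their integrals over the events of sigma(X_s) agree,
    which the martingale property and [markov_kernel] give. *)
Lemma martingale_kernel s t : 0 < s -> s < t ->
  {ae P, forall w, (M s w)%:E =
     kernel_mean (g t)^\+%R s t (X s w) - kernel_mean (g t)^\-%R s t (X s w)}%E.
Proof.
move=> s0 st; have t0 : 0 < t by exact: lt_trans st.
have mXs := measurable_BM (ltW s0).
have mX_t := measurable_BM (ltW t0).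
have XtE w : X t w = addtup (X s w) (subtup (X t w) (X s w)).
  by apply: eq_from_tnth => i; rewrite !tnth_mktuple addrC subrK.
have kern (f : d.-tuple R -> R) : measurable_fun setT f -> (forall x, 0 <= f x) ->
    P.-integrable setT (fun w => (f (X t w))%:E) ->
    [/\ measurable_fun setT (kernel_mean f s t),
        P.-integrable setT (kernel_mean f s t \o X s) &
        forall B, measurable B -> (\int[P]_(w in X s @^-1` B) (f (X t w))%:E =
          \int[P]_(w in X s @^-1` B) (kernel_mean f s t (X s w)))%E].
  move=> mf f0 iF.
  have mEf : measurable_fun setT (EFin \o f) by exact/measurable_EFinP.
  have Ef0 z : (0 <= (EFin \o f) z)%E by rewrite lee_fin.
  have [mF FB] := markov_kernel s0 st mXs (gaussian_increment (ltW s0) st)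
    (gaussian_BM t0) XtE (fun A B => BM_independent (ltW s0) st) mEf Ef0.
  split => //; apply/integrableP; split; first exact: measurableT_comp mF mXs.
  under eq_integral => w _.
    rewrite gee0_abs; last first.
      apply: integral_ge0 => w' _.
      by rewrite mule_ge0// lee_fin ?gauss_ratio_ge0.
    over.
  move: (FB setT measurableT); rewrite preimage_setT => <-.
  exact: integrable_lty.
have igt := integrable_gX (ltW t0).
have mgt := g_meas (ltW t0).
have ip : P.-integrable setT (fun w => ((g t)^\+%R (X t w))%:E).
  exact: (integrable_funrpos (f := fun w => g t (X t w))).
have im : P.-integrable setT (fun w => ((g t)^\-%R (X t w))%:E).
  exact: (integrable_funrneg (f := fun w => g t (X t w))).
have [mFp iFp FpB] := kern (g t)^\+ (measurable_funrpos mgt) (funrpos_ge0 _) ip.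
have [mFm iFm FmB] := kern (g t)^\- (measurable_funrneg mgt) (funrneg_ge0 _) im.
pose XsM : {mfun Omega >-> d.-tuple R} :=
  HB.pack (X s) (isMeasurableFun.Build _ _ _ _ (X s) mXs).
pose gam : probability _ R := distribution P XsM.
have mgs : measurable_fun setT (EFin \o g s) by apply/measurable_EFinP; exact: g_meas (ltW s0).
have igs : gam.-integrable setT (EFin \o g s).
  apply: integrable_pushforward => //; rewrite preimage_setT.
  exact: integrable_gX (ltW s0).
pose D x := (kernel_mean (g t)^\+%R s t x - kernel_mean (g t)^\-%R s t x)%E.
have mD : measurable_fun setT D by exact: emeasurable_funB.
have iD : P.-integrable setT (D \o X s) by exact: integrableB.
have : ae_eq gam setT (EFin \o g s) D.
  apply: integral_ae_eq => // B _ mB.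
  have mXB : measurable (X s @^-1` B).
    by rewrite -[X in measurable X]setTI; exact: (mXs measurableT B mB).
  rewrite !integral_pushforward//; first last.
  - by apply: (integrableS measurableT) => //; exact: integrable_gX (ltW s0).
  - by apply: (integrableS measurableT).
  rewrite -[LHS](integral_martingale (ltW s0) mXB).
  rewrite (martingale_event (ltW s0) (ltW st) mB) (integral_martingale (ltW t0) mXB).
  rewrite integralB//; [|exact: integrableS iFp|exact: integrableS iFm].
  rewrite -FpB// -FmB// -integralB_EFin//; [|exact: integrableS ip|exact: integrableS im].
  apply: eq_integral => w _; rewrite -EFinB; congr EFin.
  by rewrite -[in LHS](funrposBneg (g t)).
move=> [N [mN N0 gN]].
have XsN : {ae P, forall w, ~ N (X s w)}.
  exists (X s @^-1` N); split=> //; last by move=> w /contrapT.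
  by rewrite -[X in measurable X]setTI; exact: (mXs measurableT N mN).
apply: filterS2 XsN (M_g (ltW s0)) => w nN ->.
by apply: contrapT => neq; apply: nN; apply: gN => /= H; apply: neq; exact: H.
Qed.

End brownian_martingale.

(** * The representing measures *)

Lemma exp_kernel_bounded (R : realType) (d : nat) (t : R) (x : d.-tuple R) :
  0 < t -> [bounded exp_kernel t x v | v in [set: d.-tuple R]].
Proof.
move=> t0; exists (expR (dotp x x / (2 * t))); split; first exact: num_real.
move=> N /ltW HN v _ /=; rewrite ger0_norm ?exp_kernel_ge0//.
exact: le_trans (exp_kernel_le x v t0) HN.
Qed.

Lemma measurable_exp_kernelr (R : realType) (d : nat) (t : R) (x : d.-tuple R) :
  measurable_fun setT (exp_kernel t x).
Proof.
exact: (@measurable_exp_kernel R d _ (d.-tuple R) t (fun=> x) id).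
Qed.

Lemma integrable_exp_kernel (R : realType) (d : nat) (t : R) (x : d.-tuple R)
    (nu : {measure set (d.-tuple R) -> \bar R}) : 0 < t -> (nu setT < +oo)%E ->
  nu.-integrable setT (EFin \o exp_kernel t x).
Proof.
move=> t0 nuT; apply: measurable_bounded_integrable => //.
- exact: measurable_exp_kernelr.
- exact: exp_kernel_bounded.
Qed.

(** Vague convergence also holds for the kernels [gauss_ratio], which depend on [n],
    since they converge uniformly and the masses are bounded. *)
Lemma vague_gauss_ratio_cvg (R : realType) (d : nat) (U : set_system nat)
    (FU : ProperFilter U) (K : R) (nu : nat -> {measure set (d.-tuple R) -> \bar R})
    (l s : R) (x : d.-tuple R) :
  \oo `<=` U -> (forall n, (nu n setT <= K%:E)%E) -> 0 < s ->
  \int[nu n]_u exp_kernel s x u @[n --> U] --> l ->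
  \int[nu n]_u gauss_ratio s n%:R x (scaletup n%:R u) @[n --> U] --> l.
Proof.
move=> ooU nuK s0 kl.
have nuT n : (nu n setT < +oo)%E by exact: le_lt_trans (nuK n) (ltry K).
have K0 : 0 <= K by rewrite -lee_fin (le_trans _ (nuK 0%N)).
apply/cvgrPdist_le => e e0.
have e20 : 0 < e / 2 by rewrite divr_gt0.
have K1 : 0 < K + 1 by rewrite ltr_wpDl.
have eK0 : 0 < e / 2 / (K + 1) by rewrite divr_gt0.
move/cvgrPdist_le : kl => /(_ _ e20).
have := ooU _ (gauss_ratio_cvg x s0 eK0).
apply: filterS2 => n Hn ln.
set I := Rintegral _ _ _ in ln; set J := Rintegral _ _ _.
rewrite -(subrK I l) -addrA (le_trans (ler_normD _ _))//.
rewrite [leRHS]splitr lerD// distrC.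
have mq : measurable_fun setT
    (fun u : d.-tuple R => gauss_ratio s n%:R x (scaletup n%:R u)).
  exact: measurableT_comp (measurable_gauss_ratio s n%:R x) (measurable_scaletup _).
have ik := integrable_exp_kernel x s0 (nuT n).
have iq : (nu n).-integrable setT
    (EFin \o (fun u : d.-tuple R => gauss_ratio s n%:R x (scaletup n%:R u))).
  apply: measurable_bounded_integrable => //.
  exists (e / 2 / (K + 1) + expR (dotp x x / (2 * s))); split; first exact: num_real.
  move=> N /ltW HN u _ /=; apply: le_trans HN.
  rewrite -(subrK (exp_kernel s x u) (gauss_ratio s n%:R x _)).
  rewrite (le_trans (ler_normD _ _))// lerD//.
  by rewrite ger0_norm ?exp_kernel_ge0// exp_kernel_le.
have iqk : (nu n).-integrable setT (EFin \o (fun u : d.-tuple R =>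
    gauss_ratio s n%:R x (scaletup n%:R u) - exp_kernel s x u)).
  rewrite (_ : _ \o _ = ((EFin \o (fun u : d.-tuple R =>
    gauss_ratio s n%:R x (scaletup n%:R u))) \- (EFin \o exp_kernel s x))%E)//.
  exact: integrableB.
rewrite /J /I -RintegralB//.
apply: (le_trans (le_normr_Rintegral measurableT iqk)).
apply: (@le_trans _ _ (\int[nu n]_(u in [set: d.-tuple R]) (e / 2 / (K + 1)))).
  apply: le_Rintegral => //; first exact: integrable_norm.
  apply: measurable_bounded_integrable => //.
  exists (e / 2 / (K + 1)); split; first exact: num_real.
  by move=> N /ltW HN u _ /=; rewrite ger0_norm// ltW.
rewrite Rintegral_cst// mulrAC ler_pdivrMr// ler_wpM2l ?(ltW e20)//.
rewrite (@le_trans _ _ K)//; last by rewrite lerDl.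
by rewrite -lee_fin fineK ?nuK// ge0_fin_numE.
Qed.

Section representation.
Context {R : realType} {disp : measure_display} {Omega : measurableType disp}.
Context (P : probability Omega R) {d : nat}.
Variable X : R -> Omega -> d.-tuple R.
Hypothesis X_BM : brownian_motion P X.
Variables (M : R -> Omega -> R) (g : R -> d.-tuple R -> R).
Hypothesis M_mart : martingale P (augmented_filtration P X) M.
Hypothesis M_L1 : (sup_L1norm P M < +oo)%E.
Hypothesis g_meas : forall t, 0 <= t -> measurable_fun setT (g t).
Hypothesis M_g : forall t, 0 <= t -> {ae P, forall w, M t w = g t (X t w)}.

Lemma L1norm_le_sup t : 0 <= t -> (\int[P]_w `|M t w|%:E <= sup_L1norm P M)%E.
Proof.
move=> t0; apply: ereal_sup_ubound; exists t => //.
by rewrite unlock.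
Qed.

(** The measures whose vague limits are sought. The scaling is the one for which
    X_t / t, under the density E(v.X)_t, concentrates at [v]. *)
Lemma scaled_weighted_law (f : d.-tuple R -> R) (t : R) : 0 <= t ->
  measurable_fun setT f -> (forall x, 0 <= f x) ->
  exists nu : {measure set (d.-tuple R) -> \bar R},
    forall h : d.-tuple R -> \bar R, measurable_fun setT h -> (forall y, 0 <= h y)%E ->
    (\int[nu]_u h u = \int[P]_w ((f (X t w))%:E * h (scaletup t^-1 (X t w))))%E.
Proof.
move=> t0 mf f0; have mX := measurable_BM X_BM t0.
apply: weighted_image_measure => //.
- exact: measurableT_comp mf mX.
- exact: measurableT_comp (measurable_scaletup _) mX.
Qed.

Lemma scaled_law_mass (f : d.-tuple R -> R) (t : R) (nu : {measure set (d.-tuple R) -> \bar R}) :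
  (forall h : d.-tuple R -> \bar R, measurable_fun setT h -> (forall y, 0 <= h y)%E ->
    (\int[nu]_u h u = \int[P]_w ((f (X t w))%:E * h (scaletup t^-1 (X t w))))%E) ->
  nu setT = (\int[P]_w (f (X t w))%:E)%E.
Proof.
move=> nuE; rewrite -[LHS]mul1e -(integral_cst nu measurableT) nuE//.
by apply: eq_integral => w _; rewrite mule1.
Qed.

Lemma kernel_mean_scaled (f : d.-tuple R -> R) (s t : R)
    (nu : {measure set (d.-tuple R) -> \bar R}) x : 0 < t ->
  (forall h : d.-tuple R -> \bar R, measurable_fun setT h -> (forall y, 0 <= h y)%E ->
    (\int[nu]_u h u = \int[P]_w ((f (X t w))%:E * h (scaletup t^-1 (X t w))))%E) ->
  kernel_mean P X f s t x =
    (\int[nu]_u (gauss_ratio s t x (scaletup t u))%:E)%E.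
Proof.
move=> t0 nuE; rewrite nuE.
- apply: eq_integral => w _; rewrite muleC; congr (_ * (gauss_ratio s t x _)%:E)%E.
  by apply: eq_from_tnth => i; rewrite !tnth_mktuple mulrA divff ?mul1r// gt_eqF.
- apply/measurable_EFinP.
  exact: measurableT_comp (measurable_gauss_ratio s t x) (measurable_scaletup _).
- by move=> u; rewrite lee_fin gauss_ratio_ge0.
Qed.

(** The limit of [martingale_kernel] along the integers [t = n]. The bound on the
    masses holds because it does for each [n] and mass can only escape. *)
Theorem representation_fixed_time : exists alpha beta : {measure set (d.-tuple R) -> \bar R},
  (alpha setT + beta setT <= sup_L1norm P M)%E /\
  forall s, 0 < s -> {ae P, forall w,
    M s w = \int[alpha]_v exp_kernel s (X s w) v - \int[beta]_v exp_kernel s (X s w) v}.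
Proof.
have sup0 : (0 <= sup_L1norm P M)%E.
  apply: le_trans (L1norm_le_sup (lexx 0)).
  by apply: integral_ge0 => w _; rewrite lee_fin.
pose K := fine (sup_L1norm P M).
have KE : K%:E = sup_L1norm P M by rewrite fineK// ge0_fin_numE.
have n0 (n : nat) : 0 <= n%:R :> R by [].
have nuP n := scaled_weighted_law (n0 n) (measurable_funrpos (g_meas (n0 n)))
  (funrpos_ge0 (g n%:R)).
have nuN n := scaled_weighted_law (n0 n) (measurable_funrneg (g_meas (n0 n)))
  (funrneg_ge0 (g n%:R)).
have [nup nupE] := choice nuP.
have [num numE] := choice nuN.
have mass n : (nup n setT + num n setT <= K%:E)%E.
  rewrite (scaled_law_mass (nupE n)) (scaled_law_mass (numE n)) KE.
  have igX := integrable_gX X_BM M_mart g_meas M_g (n0 n).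
  have mgX : measurable_fun setT (fun w => g n%:R (X n%:R w)).
    exact: measurableT_comp (g_meas (n0 n)) (measurable_BM X_BM (n0 n)).
  rewrite -ge0_integralD//; first last.
  - apply/measurable_EFinP; exact: (measurable_funrneg mgX).
  - by move=> w _; rewrite lee_fin funrneg_ge0.
  - apply/measurable_EFinP; exact: (measurable_funrpos mgX).
  - by move=> w _; rewrite lee_fin funrpos_ge0.
  apply: le_trans (L1norm_le_sup (n0 n)).
  have iM := martingale_integrable M_mart (n0 n).
  rewrite le_eqVlt; apply/orP; left; apply/eqP.
  apply: ae_eq_integral => //.
  - apply: emeasurable_funD; apply/measurable_EFinP.
      exact: (measurable_funrpos mgX).
    exact: (measurable_funrneg mgX).
  - apply/measurable_EFinP/measurableT_comp => //.
    by apply/measurable_EFinP; exact: (measurable_int P iM).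
  - apply: filterS (M_g (n0 n)) => w -> _; rewrite -EFinD; congr EFin.
    exact: (congr1 (fun h => h (X n%:R w)) (funrposDneg (g n%:R))).
have nupK n : (nup n setT <= K%:E)%E by apply: le_trans (mass n); rewrite leeDl.
have numK n : (num n setT <= K%:E)%E by apply: le_trans (mass n); rewrite leeDr.
have [U [UU ooU]] := ultraFilterLemma eventually_filter.
have [alpha [alphaT alphaC]] := vague_limit UU nupK.
have [beta [betaT betaC]] := vague_limit UU numK.
have finK (nu : {measure set (d.-tuple R) -> \bar R}) : (nu setT <= K%:E)%E ->
    nu setT \is a fin_num.
  by move=> nuK; rewrite ge0_fin_numE// (le_lt_trans nuK)// ltry.
have bnd (nu : nat -> {measure set (d.-tuple R) -> \bar R}) :
    (forall n, nu n setT <= K%:E)%E -> forall n, 0 <= fine (nu n setT) <= K.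
  by move=> nuK n; rewrite fine_ge0//= -lee_fin fineK ?nuK// finK.
exists alpha, beta; split.
  have ca := ultra_bounded_cvg UU (bnd _ nupK).
  have cb := ultra_bounded_cvg UU (bnd _ numK).
  have cab : fine (nup n setT) + fine (num n setT) @[n --> U] -->
      lim (fine (nup n setT) @[n --> U]) + lim (fine (num n setT) @[n --> U]).
    exact: cvgD.
  apply: (le_trans (leeD alphaT betaT)); rewrite -EFinD -KE lee_fin.
  rewrite -(cvg_lim (@Rhausdorff R) cab); apply: limr_le.
    by apply/cvg_ex; eexists; exact: cab.
  apply: filterE => n; rewrite -lee_fin EFinD.
  by rewrite (fineK (finK _ (nupK n))) (fineK (finK _ (numK n))); exact: mass.
move=> s s0.
have : {ae P, forall w, forall n : nat, s < n%:R -> ((M s w)%:E =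
    kernel_mean P X (g n%:R)^\+%R s n%:R (X s w) -
    kernel_mean P X (g n%:R)^\-%R s n%:R (X s w))%E}.
  apply: ae_foralln => n; have [sn|ns] := ltP s n%:R; last first.
    by apply: aeW => w.
  by apply: filterS (martingale_kernel X_BM M_mart g_meas M_g s0 sn) => w Hw _.
apply: filterS => w Mw.
have kC : C0_fun (exp_kernel s (X s w)) by exact: exp_kernel_C0.
have km := measurable_exp_kernelr s (X s w).
have kb := exp_kernel_bounded (X s w) s0.
have FU : ProperFilter U := @ultra_proper _ _ UU.
have cp := @vague_gauss_ratio_cvg _ _ U FU _ _ _ _ _ ooU nupK s0 (alphaC _ km kC kb).
have cm := @vague_gauss_ratio_cvg _ _ U FU _ _ _ _ _ ooU numK s0 (betaC _ km kC kb).
have cM : \int[nup n]_u gauss_ratio s n%:R (X s w) (scaletup n%:R u) -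
      \int[num n]_u gauss_ratio s n%:R (X s w) (scaletup n%:R u) @[n --> U] -->
    \int[alpha]_v exp_kernel s (X s w) v - \int[beta]_v exp_kernel s (X s w) v.
  exact: cvgB.
rewrite -(cvg_lim (@Rhausdorff R) cM); apply/esym/cvg_lim => //.
apply: cvg_near_cst; apply: ooU; near=> n.
have sn : s < n%:R by near: n; exact: nbhs_infty_gtr.
have nn : 0 < n%:R :> R by exact: lt_trans sn.
have := Mw n sn.
rewrite (kernel_mean_scaled s (X s w) nn (nupE n)).
rewrite (kernel_mean_scaled s (X s w) nn (numE n)) => MwE.
have /andP[finp finm] : (\int[nup n]_u (gauss_ratio s n%:R (X s w) (scaletup n%:R u))%:E
    \is a fin_num)%E && (\int[num n]_u (gauss_ratio s n%:R (X s w) (scaletup n%:R u))%:E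
    \is a fin_num)%E by rewrite -fin_numB -MwE.
by rewrite /Rintegral -fineB// -MwE.
Unshelve. all: by end_near. Qed.

End representation.

(** * From fixed times to all times *)

Lemma within_continuous_seq (R : realType) (f : R -> R) (u : nat -> R) (t : R) :
  {within `[0, +oo[, continuous f} -> 0 < t -> u n @[n --> \oo] --> t ->
  f (u n) @[n --> \oo] --> f t.
Proof.
move=> cf t0 ut.
have cf' : {within `]0, +oo[, continuous f}.
  by apply: continuous_subspaceW cf => x /=; rewrite !in_itv/= !andbT => /ltW.
have oI : open (`]0, +oo[%classic : set R) by exact: interval_open.
move: cf'; rewrite continuous_open_subspace// => /(_ t).
have t_in : t \in `]0, +oo[%classic by rewrite inE/= in_itv/= t0.
by move=> /(_ t_in) ft; exact: cvg_comp ut ft.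
Qed.

Lemma rational_seq_right (R : realType) (t : R) : exists q : nat -> rat,
  (forall n, t < ratr (q n)) /\ ratr (q n) @[n --> \oo] --> t.
Proof.
have qP (n : nat) : exists q : rat, t < ratr q < t + n.+1%:R^-1.
  have /rat_in_itvoo[q] : t < t + n.+1%:R^-1 by rewrite ltrDl.
  by move=> /itvP qt; exists q; rewrite !qt.
have [q qt] := choice qP.
exists q; split=> [n|]; first by have /andP[] := qt n.
apply: (@squeeze_cvgr _ _ _ _ (fun=> t) (fun n => t + n.+1%:R^-1)).
- by apply: nearW => n; have /andP[/ltW -> /ltW ->] := qt n.
- exact: cvg_cst.
- rewrite -[X in _ --> X]addr0; apply: cvgD; first exact: cvg_cst.
  exact: cvg_harmonic.
Qed.

Section kernel_integral_continuity.
Context {R : realType} {d : nat}.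
Variable nu : {measure set (d.-tuple R) -> \bar R}.
Hypothesis nuT : (nu setT < +oo)%E.

(** The times stay above [t > 0], so that [exp_kernel_le] bounds the integrands
    uniformly, and dominated convergence applies. *)
Lemma exp_kernel_integral_cvg (t : R) (x : d.-tuple R) (tn : nat -> R)
    (xn : nat -> d.-tuple R) :
  0 < t -> (forall n, t <= tn n) -> tn n @[n --> \oo] --> t ->
  (forall i, tnth (xn n) i @[n --> \oo] --> tnth x i) ->
  \int[nu]_v exp_kernel (tn n) (xn n) v @[n --> \oo] --> \int[nu]_v exp_kernel t x v.
Proof.
move=> t0 tnt tn_cvg xn_cvg.
have dot_cvg (v : nat -> d.-tuple R) (w : d.-tuple R) :
    (forall i, tnth (v n) i @[n --> \oo] --> tnth w i) ->
    dotp (v n) (xn n) @[n --> \oo] --> dotp w x.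
  by move=> vw; apply: cvgr_sum => i; apply: cvgM.
have [B [_ xB]] : bounded_fun (fun n => dotp (xn n) (xn n)).
  apply: (@cvg_seq_bounded _ R^o); apply/cvg_ex; exists (dotp x x).
  exact: dot_cvg.
pose C := expR ((B + 1) / (2 * t)).
have tn0 n : 0 < tn n by exact: lt_le_trans (tnt n).
have kC n v : exp_kernel (tn n) (xn n) v <= C.
  apply: (le_trans (exp_kernel_le _ _ (tn0 n))); rewrite ler_expR.
  apply: (@le_trans _ _ (dotp (xn n) (xn n) / (2 * t))).
    by rewrite ler_wpM2l ?dotp_ge0// lef_pV2 ?posrE ?mulr_gt0// ler_pM2l.
  rewrite ler_wpM2r ?invr_ge0 ?mulr_ge0 ?(ltW t0)//.
  by apply: (le_trans (ler_norm _)); apply: (xB (B + 1)); rewrite ?ltrDl.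
have [] := @dominated_convergence _ _ _ nu setT measurableT
  (fun n v => (exp_kernel (tn n) (xn n) v)%:E) (fun v => (exp_kernel t x v)%:E)
  (fun=> C%:E).
- by move=> n; apply/measurable_EFinP; exact: measurable_exp_kernelr.
- by apply/measurable_EFinP; exact: measurable_exp_kernelr.
- apply: aeW => v _; apply/cvg_EFin; first by apply: nearW.
  apply: (cvg_comp (fun n => dotp v (xn n) - 2^-1 * dotp v v * tn n) expR); last first.
    exact: continuous_expR.
  apply: cvgB; first by apply: (dot_cvg (fun=> v)) => i; exact: cvg_cst.
  by apply: cvgM => //; exact: cvg_cst.
- apply: (@measurable_bounded_integrable _ _ _ nu (fun=> C)) => //.
  exists C; split; first exact: num_real.
  by move=> N /ltW CN v _ /=; rewrite ger0_norm ?expR_ge0.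
- apply: aeW => v n _; rewrite /= lee_fin ger0_norm ?exp_kernel_ge0//.
move=> _ _ cvgI; apply: fine_cvg.
rewrite fineK; last by apply: integrable_fin_num => //; exact: integrable_exp_kernel.
exact: cvgI.
Qed.

End kernel_integral_continuity.

Section all_times.
Context {R : realType} {disp : measure_display} {Omega : measurableType disp}.
Context (P : probability Omega R) {d : nat}.
Variable X : R -> Omega -> d.-tuple R.
Hypothesis X_BM : brownian_motion P X.
Variable M : R -> Omega -> R.
Hypothesis M_cont : continuous_process P M.
Variables alpha beta : {measure set (d.-tuple R) -> \bar R}.
Hypotheses (alphaT : (alpha setT < +oo)%E) (betaT : (beta setT < +oo)%E).

(** Both sides are continuous in [t] almost surely, so that it is enough to have the
    equality at rational times. *)
Lemma representation_positive_times :
  (forall s, 0 < s -> {ae P, forall w, M s w =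
     \int[alpha]_v exp_kernel s (X s w) v - \int[beta]_v exp_kernel s (X s w) v}) ->
  {ae P, forall w t, 0 < t -> M t w =
     \int[alpha]_v exp_kernel t (X t w) v - \int[beta]_v exp_kernel t (X t w) v}.
Proof.
move=> Ms; have [_ _ Xc _ _] := X_BM.
pose I t w := \int[alpha]_v exp_kernel t (X t w) v - \int[beta]_v exp_kernel t (X t w) v.
(* Rational times are enumerated by integers, to take a countable intersection. *)
have Mq : {ae P, forall w, forall k : nat,
    let q : rat := odflt 0 (unpickle k) in 0 < ratr q :> R ->
    M (ratr q) w = I (ratr q) w}.
  apply: ae_foralln => k; set q := odflt _ _; have [q0|q0] := ltP 0 (ratr q : R).
    by apply: filterS (Ms _ q0) => w.
  by apply: aeW => w /= q1; have := lt_le_trans q1 q0; rewrite ltxx.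
have Xc' : {ae P, forall w, forall i : 'I_d,
    {within `[0, +oo[, continuous (fun t => tnth (X t w) i)}}.
  exact: filter_forall.
apply: filterS3 Mq Xc' M_cont => w Mq Xw Mw t t0.
have [q [qt q_cvg]] := rational_seq_right t.
have cM : M (ratr (q n)) w @[n --> \oo] --> M t w.
  exact: (within_continuous_seq Mw t0 q_cvg).
have cX i : tnth (X (ratr (q n)) w) i @[n --> \oo] --> tnth (X t w) i.
  exact: (within_continuous_seq (Xw i) t0 q_cvg).
have cI : I (ratr (q n)) w @[n --> \oo] --> I t w.
  by apply: cvgB; apply: exp_kernel_integral_cvg => // n; exact: ltW.
have MI : (fun n => M (ratr (q n)) w) = (fun n => I (ratr (q n)) w).
  apply/funext => n; have := Mq (pickle (q n)); rewrite pickleK /=; apply.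
  exact: lt_trans (qt n).
rewrite MI in cM; exact: (cvg_unique (@Rhausdorff R) cM cI).
Qed.

Lemma exp_kernel0 (v : d.-tuple R) : exp_kernel 0 [tuple 0 | i < d] v = 1.
Proof.
rewrite /exp_kernel mulr0 subr0 /dotp big1 ?expR0// => i _.
by rewrite tnth_mktuple mulr0.
Qed.

(** The coordinates are independent, and each factor has mean [1] by
    [normal_exp_moment]. *)
Lemma exp_kernel_mean t v : 0 <= t ->
  (\int[P]_w (exp_kernel t (X t w) v)%:E = 1)%E.
Proof.
rewrite le_eqVlt => /predU1P[<-|t0].
  rewrite (_ : 1%E = \int[P]_w (cst 1%E) w)%E; last first.
    by rewrite integral_cst// mul1e; apply/esym; exact: probability_setT.
  apply: ae_eq_integral => //.
    apply/measurable_EFinP; apply: (measurable_exp_kernel 0 (g := fun=> v)) => //.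
    exact: measurable_BM X_BM _ (lexx 0).
  by apply: filterS (BM0_ae X_BM) => w -> _; rewrite exp_kernel0.
have [mX Xlaw] := gaussian_BM X_BM t0.
have [N [NE N_int]] := normal_prob_default 0 (Num.sqrt t).
have XlawN (C : 'I_d -> set R) : (forall i, measurable (C i)) ->
    P [set w | forall i, C i (tnth (X t w) i)] = (\prod_(i < d) N (C i))%E.
  by move=> mC; rewrite Xlaw//; apply: eq_bigr => i _; rewrite NE.
pose f (i : 'I_d) (z : R) := expR (tnth v i * z - 2^-1 * (tnth v i * tnth v i) * t).
have mf i : measurable_fun setT (f i).
  by apply: measurableT_comp => //; apply: measurable_funB.
have f0 i z : 0 <= f i z by exact: expR_ge0.
have Nf i : (\int[N]_z (f i z)%:E = 1)%E.
  rewrite N_int ?normal_exp_moment//; first exact/measurable_EFinP.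
  by move=> z; rewrite lee_fin.
transitivity (\int[P]_w (\prod_(i < d) f i (tnth (X t w) i))%:E)%E.
  apply: eq_integral => w _; rewrite /f -expR_sum /exp_kernel exponentE.
  congr (expR _)%:E; apply: eq_bigr => i _; rewrite expr2.
  by congr (_ - _); rewrite mulrAC.
rewrite (integral_prod_coords mX XlawN)//; last by move=> i; rewrite Nf ltry.
by rewrite big1.
Qed.

Lemma exp_kernel_integral_mean t (nu : {measure set (d.-tuple R) -> \bar R}) :
  0 <= t -> (nu setT < +oo)%E ->
  (\int[P]_w \int[nu]_v (exp_kernel t (X t w) v)%:E = nu setT)%E.
Proof.
move=> t0 nuT.
have [nu' nu'E] := finite_measure_copy nuT.
have mX := measurable_BM X_BM t0.
pose f (wv : Omega * d.-tuple R) := (exp_kernel t (X t wv.1) wv.2)%:E.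
have mf : measurable_fun setT f.
  apply/measurable_EFinP; apply: measurable_exp_kernel => //.
  exact: measurableT_comp mX measurable_fst.
have f0 wv : (0 <= f wv)%E by rewrite lee_fin exp_kernel_ge0.
transitivity (\int[P]_w \int[nu']_v f (w, v))%E.
  by apply: eq_integral => w _; apply: eq_measure_integral => A mA _; symmetry; exact: nu'E.
rewrite (@fubini_tonelli _ _ _ _ _ P nu' f mf f0).
rewrite (eq_integral (cst 1%E)) => [|v _]; last exact: exp_kernel_mean.
by rewrite integral_cst// mul1e; exact: nu'E.
Qed.

End all_times.

(** * The signed measure *)

Section signed_difference.
Context disp (E : measurableType disp) (R : realType).
Variables alpha beta : {measure set E -> \bar R}.
Hypotheses (alphaT : (alpha setT < +oo)%E) (betaT : (beta setT < +oo)%E).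

Lemma charge_difference : exists mu : {charge set E -> \bar R},
  forall A, measurable A -> mu A = (alpha A - beta A)%E.
Proof.
have [a aE] := finite_measure_copy alphaT; have [b bE] := finite_measure_copy betaT.
exists (cadd (charge_of_finite_measure a)
  (cscale (-1) (charge_of_finite_measure b))) => A mA.
by transitivity (a A + (-1)%:E * b A)%E => //; rewrite aE bE mulN1e.
Qed.

Variable mu : {charge set E -> \bar R}.
Hypothesis muE : forall A, measurable A -> mu A = (alpha A - beta A)%E.

Let pos := jordan_pos (hahnP mu).
Let neg := jordan_neg (hahnP mu).

Let fin (nu : {measure set E -> \bar R}) A : (nu setT < +oo)%E -> measurable A ->
  nu A \is a fin_num.
Proof.
move=> nuT mA; rewrite ge0_fin_numE//; apply: le_lt_trans nuT.
by apply: le_measure; rewrite ?inE.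
Qed.

(** The Jordan decomposition of [mu] need not be [(alpha, beta)]; but [pos + beta] and
    [alpha + neg] are the same measure, and all the integrals are finite. *)
Lemma signed_integral_difference (h : E -> R) :
  measurable_fun setT h -> (forall x, 0 <= h x) -> [bounded h x | x in setT] ->
  signed_integral mu (EFin \o h) = (\int[alpha]_x h x - \int[beta]_x h x)%:E.
Proof.
move=> mh h0 bh.
have mEh : measurable_fun setT (EFin \o h) by exact/measurable_EFinP.
have Eh0 x : [set: E] x -> (0 <= (EFin \o h) x)%E by move=> _; rewrite lee_fin.
have ih (nu : {measure set E -> \bar R}) : (nu setT < +oo)%E ->
    (\int[nu]_x (h x)%:E)%E \is a fin_num.
  move=> nuT; apply: integrable_fin_num => //.
  exact: measurable_bounded_integrable.
have posT : (pos setT < +oo)%E by rewrite -ge0_fin_numE// fin_num_measure.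
have negT : (neg setT < +oo)%E by rewrite -ge0_fin_numE// fin_num_measure.
have key : (\int[pos]_x (h x)%:E + \int[beta]_x (h x)%:E =
            \int[alpha]_x (h x)%:E + \int[neg]_x (h x)%:E)%E.
  rewrite -!ge0_integral_measure_add//; apply: eq_measure_integral => A mA _.
  rewrite /= /msum !big_ord_recr !big_ord0 /= !add0e.
  have := jordan_decomp (hahnP mu) mA; rewrite muE// /cadd/= cscaleN1/=.
  rewrite -/pos -/neg.
  have := fin alphaT mA; have := fin betaT mA; have := fin posT mA; have := fin negT mA.
  move: (pos A) (neg A) (alpha A) (beta A) => [p| |] [q| |] [a| |] [b| |] //= _ _ _ _.
  rewrite -!EFinB => -[ab]; rewrite -!EFinD; congr EFin.
  lra.
rewrite /signed_integral -/pos -/neg /Rintegral EFinB !fineK ?ih//.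
move: key.
have := ih _ alphaT; have := ih _ betaT; have := ih _ posT; have := ih _ negT.
rewrite /comp.
move: (\int[pos]_x (h x)%:E)%E (\int[neg]_x (h x)%:E)%E (\int[alpha]_x (h x)%:E)%E
  (\int[beta]_x (h x)%:E)%E => [p| |] [q| |] [a| |] [b| |] //= _ _ _ _.
rewrite -!EFinD => -[pb]; congr EFin; lra.
Qed.

(** On the positive set [mu] is at most [alpha], on the negative set [- mu] is at most
    [beta]. *)
Lemma tv_measure_difference : (tv_measure mu setT <= alpha setT + beta setT)%E.
Proof.
have [[mp _] [mn _] _ _] := hahnP mu.
rewrite /tv_measure /charge_variation; apply: leeD.
  rewrite jordan_posE cjordan_posE /crestr0 mem_set// /crestr setTI muE//.
  apply: (@le_trans _ _ (alpha (hahn_pos mu))).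
    by rewrite leeBlDr ?leeDl// fin.
  by apply: le_measure; rewrite ?inE.
rewrite jordan_negE cjordan_negE /crestr0 mem_set// /crestr setTI muE//.
rewrite fin_num_oppeB ?fin// addeC.
apply: (@le_trans _ _ (beta (hahn_neg mu))).
  by rewrite leeBlDr ?leeDl// fin.
by apply: le_measure; rewrite ?inE.
Qed.

End signed_difference.

(** * The representation at all times and the norm *)

Section representation_all_times.
Context {R : realType} {disp : measure_display} {Omega : measurableType disp}.
Context (P : probability Omega R) {d : nat}.
Variable X : R -> Omega -> d.-tuple R.
Hypothesis X_BM : brownian_motion P X.
Variables (M : R -> Omega -> R) (g : R -> d.-tuple R -> R).
Hypothesis M_mart : martingale P (augmented_filtration P X) M.
Hypothesis M_g : forall t, 0 <= t -> {ae P, forall w, M t w = g t (X t w)}.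

Lemma integrable_exp_kernel_integral t (nu : {measure set (d.-tuple R) -> \bar R}) :
  0 <= t -> (nu setT < +oo)%E ->
  P.-integrable setT (fun w => \int[nu]_v (exp_kernel t (X t w) v)%:E)%E.
Proof.
move=> t0 nuT; have [nu' nu'E] := finite_measure_copy nuT.
have mX := measurable_BM X_BM t0.
apply/integrableP; split.
  rewrite (_ : (fun w => _) =
      (fun w => \int[nu']_v (exp_kernel t (X t w) v)%:E)%E); last first.
    by apply/funext => w; apply: eq_measure_integral => A mA _; symmetry; exact: nu'E.
  apply: (@measurable_fun_fubini_tonelli_F _ _ _ _ _ nu'
    (fun wv => (exp_kernel t (X t wv.1) wv.2)%:E)).
    apply/measurable_EFinP; apply: measurable_exp_kernel => //.
    exact: measurableT_comp mX measurable_fst.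
  by move=> wv; rewrite lee_fin exp_kernel_ge0.
under eq_integral => w _.
  rewrite gee0_abs; last by apply: integral_ge0 => v _; rewrite lee_fin exp_kernel_ge0.
  over.
by rewrite exp_kernel_integral_mean.
Qed.

Variables alpha beta : {measure set (d.-tuple R) -> \bar R}.
Hypotheses (alphaT : (alpha setT < +oo)%E) (betaT : (beta setT < +oo)%E).

(** [M 0] is a constant because X_0 is; the constant is the mean of [M 1], which is
    computed with [exp_kernel_integral_mean]. *)
Lemma representation_time_zero :
  {ae P, forall w, M 1 w =
     \int[alpha]_v exp_kernel 1 (X 1 w) v - \int[beta]_v exp_kernel 1 (X 1 w) v} ->
  {ae P, forall w, M 0 w = fine (alpha setT) - fine (beta setT)}.
Proof.
move=> M1; have R01 : (0 : R) <= 1 by exact: ler01.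
pose z : d.-tuple R := [tuple 0 | i < d].
have M0 : {ae P, forall w, M 0 w = g 0 z}.
  by apply: filterS2 (M_g (lexx 0)) (BM0_ae X_BM) => w -> ->.
suff -> : fine (alpha setT) - fine (beta setT) = g 0 z by [].
have iK (nu : {measure set (d.-tuple R) -> \bar R}) w : (nu setT < +oo)%E ->
    (\int[nu]_v exp_kernel 1 (X 1 w) v)%:E =
    (\int[nu]_v (exp_kernel 1 (X 1 w) v)%:E)%E.
  move=> nuT; rewrite fineK//; apply: integrable_fin_num => //.
  exact: integrable_exp_kernel.
have mM t : 0 <= t -> measurable_fun setT (EFin \o M t).
  by move=> t0; exact: measurable_int (martingale_integrable M_mart t0).
apply: EFin_inj; rewrite EFinB !fineK ?ge0_fin_numE//.
transitivity (\int[P]_w (M 1 w)%:E)%E.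
  rewrite -(exp_kernel_integral_mean X_BM R01 alphaT).
  rewrite -(exp_kernel_integral_mean X_BM R01 betaT).
  have ia := integrable_exp_kernel_integral R01 alphaT.
  have ib := integrable_exp_kernel_integral R01 betaT.
  rewrite -integralB//; apply: ae_eq_integral => //.
  - exact: measurable_int (integrableB measurableT ia ib).
  - exact: mM.
  - by apply: filterS M1 => w -> _; rewrite EFinB !iK.
have := martingale_event M_mart (lexx 0) R01 (@measurableT _ (d.-tuple R)).
rewrite preimage_setT => <-.
rewrite (_ : \int[P]_w _ = \int[P]_w (cst (g 0 z)%:E w))%E.
  rewrite integral_cst// -[RHS]mule1; congr (_ * _)%E.
  exact: probability_setT.
apply: ae_eq_integral => //; first exact: mM.
by apply: filterS M0 => w -> _.
Qed.

(** Boundedness of the kernel is recorded, since at time [0] it holds only on the event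
    where X_0 vanishes. *)
Lemma representation_all_times : continuous_process P M ->
  (forall s, 0 < s -> {ae P, forall w, M s w =
     \int[alpha]_v exp_kernel s (X s w) v - \int[beta]_v exp_kernel s (X s w) v}) ->
  {ae P, forall w t, 0 <= t ->
     [bounded exp_kernel t (X t w) v | v in [set: d.-tuple R]] /\
     M t w = \int[alpha]_v exp_kernel t (X t w) v - \int[beta]_v exp_kernel t (X t w) v}.
Proof.
move=> M_cont Ms.
have Mpos := representation_positive_times X_BM M_cont alphaT betaT Ms.
have Mzero := representation_time_zero (Ms 1 ltr01).
apply: filterS3 Mpos Mzero (BM0_ae X_BM) => w wpos wzero X0 t.
rewrite le_eqVlt => /predU1P[<-|t0].
  rewrite X0; have -> : exp_kernel 0 [tuple (0 : R) | i < d] = cst 1.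
    by apply/funext => v; exact: exp_kernel0.
  split; last by rewrite wzero !Rintegral_cst// !mul1r.
  exists 1; split; first exact: num_real.
  by move=> N /ltW N1 v _ /=; rewrite normr1.
by split; [exact: exp_kernel_bounded|exact: wpos].
Qed.

Lemma L1norm_le_mass t (alpha' beta' : {measure set (d.-tuple R) -> \bar R}) :
  0 <= t -> (alpha' setT < +oo)%E -> (beta' setT < +oo)%E ->
  {ae P, forall w, (M t w)%:E =
    \int[alpha']_v (exp_kernel t (X t w) v)%:E -
    \int[beta']_v (exp_kernel t (X t w) v)%:E}%E ->
  ('E_P[(fun w => `|M t w|)%R] <= alpha' setT + beta' setT)%E.
Proof.
move=> t0 aT bT Mt; rewrite unlock.
rewrite -(exp_kernel_integral_mean X_BM t0 aT) -(exp_kernel_integral_mean X_BM t0 bT).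
have ia := integrable_exp_kernel_integral t0 aT.
have ib := integrable_exp_kernel_integral t0 bT.
have I0 (nu : {measure set (d.-tuple R) -> \bar R}) w :
    (0 <= \int[nu]_v (exp_kernel t (X t w) v)%:E)%E.
  by apply: integral_ge0 => v _; rewrite lee_fin exp_kernel_ge0.
rewrite -integralD//; apply: ae_ge0_le_integral => //.
- apply/measurable_EFinP/measurableT_comp => //.
  by apply/measurable_EFinP; exact: measurable_int (martingale_integrable M_mart t0).
- by move=> w _; rewrite adde_ge0.
- exact: measurable_int (integrableD measurableT ia ib).
apply: filterS Mt => w Mw _; rewrite -abse_EFin Mw.
by apply: (le_trans (lee_abs_sub _ _)); rewrite !gee0_abs.
Qed.

End representation_all_times.

Theorem proposition4p3 (R : realType) (disp : measure_display)
    (Omega : measurableType disp) (P : probability Omega R)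
    (Pcomplete : measure_is_complete P)
    (d : nat) (d_gt0 : (0 < d)%N)
    (X : R -> Omega -> d.-tuple R) (X_BM : brownian_motion P X)
    (M : R -> Omega -> R)
    (M_cont : continuous_process P M)
    (M_mart : martingale P (augmented_filtration P X) M)
    (M_L1 : (sup_L1norm P M < +oo)%E)
    (g : R -> d.-tuple R -> R)
    (g_meas : forall t : R, 0 <= t -> measurable_fun setT (g t))
    (M_g : forall t : R, 0 <= t -> {ae P, forall w, M t w = g t (X t w)}) :
  exists mu : {charge set (d.-tuple R) -> \bar R},
    {ae P, forall w, forall t : R, 0 <= t ->
       (M t w)%:E = signed_integral mu (fun v => (stochastic_exp v X t w)%:E)} /\
    sup_L1norm P M = tv_measure mu setT.
Proof.
have [alpha [beta [mass Ms]]] := representation_fixed_time X_BM M_mart M_L1 g_meas M_g.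
have alphaT : (alpha setT < +oo)%E.
  by apply: le_lt_trans M_L1; apply: le_trans mass; rewrite leeDl.
have betaT : (beta setT < +oo)%E.
  by apply: le_lt_trans M_L1; apply: le_trans mass; rewrite leeDr.
have [mu muE] := charge_difference alphaT betaT.
have repr : {ae P, forall w, forall t : R, 0 <= t ->
    (M t w)%:E = signed_integral mu (EFin \o exp_kernel t (X t w))}.
  have := representation_all_times X_BM M_mart M_g alphaT betaT M_cont Ms.
  apply: filterS => w Mw t t0; have [bk ->] := Mw t t0.
  rewrite (signed_integral_difference alphaT betaT muE)//.
  - exact: measurable_exp_kernelr.
  - by move=> v; exact: exp_kernel_ge0.
exists mu; split; first exact: repr.
apply/eqP; rewrite eq_le; apply/andP; split; last first.
  by apply: le_trans mass; exact: tv_measure_difference.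
apply: ge_ereal_sup => _ [t t0 <-].
apply: (L1norm_le_mass X_BM M_mart t0).
- by rewrite -ge0_fin_numE// fin_num_measure.
- by rewrite -ge0_fin_numE// fin_num_measure.
- by apply: filterS repr => w /(_ _ t0).
Qed.
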